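(* Let $C_n$ and the function $\rho(z_1,z_2)$, defined for $\tfrac12<z_1<1<z_2<\tfrac32$, be as in the context. The function $\rho$ attains its maximum over the region $\tfrac12<z_1<1<z_2<\tfrac32$ at a point $(z_1^*,z_2^* )$ with $z_1^*=0.72096\ldots$ and $z_2^*=1.23305\ldots$, the maximal value is $\rho(z_1^*,z_2^* )=1.08176\ldots$, and, as $n\to\infty$, $$C_n\ \ge\ \rho(z_1^*,z_2^* )\,n+O(n^{-1})=(1.08176\ldots)\,n+O(n^{-1}).$$
   Context: Decimals followed by dots give the leading digits of the (truncated) decimal expansion, e.g. $x=1.08176\ldots$ means $1.08176\le x<1.08177$. Notation: $e(t)=\exp(2\pi i t)$, $c(t)=\cos(2\pi t)$. For a real trigonometric polynomial $t_n(x)=\sum_{\nu\in\mathbb Z,\,|\nu|<n}\widehat t_n(\nu)e(\nu x)$ (degree less than $n$) put $$\|t_n\|_C=\max_{|x|\le 1/2}|t_n(x)|,\qquad \|t_n\|_L=\int_{-1/2}^{1/2}|t_n(x)|\,dx,$$ and $$C_n=\sup_{t_n}\frac{\|t_n\|_C}{\|t_n\|_L},$$ the supremum being over all nonzero real trigonometric polynomials $t_n$ of degree less than $n$. Let $q_1=\tfrac14$, $q_2=\tfrac34$, $q_3=\tfrac54$ (zeros of $c$). For $\tfrac12<z_1<1<z_2<\tfrac32$ define $$\widehat\varphi(z)=\omega(z)\,c(z),\qquad \omega(z)=\frac{(z_1^2-z^2)(z_2^2-z^2)}{(q_1^2-z^2)(q_2^2-z^2)(q_3^2-z^2)},$$ with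 the removable singularities of $\widehat\varphi$ at $z=\pm q_k$ filled in by continuity, and $$\rho(z_1,z_2)=\widehat\varphi(0)\biggl[4\biggl(\int_0^{q_1}\widehat\varphi(z)\,dz+\int_{q_2}^{q_3}\widehat\varphi(z)\,dz-\int_{z_1}^{z_2}\widehat\varphi(z)\,dz\biggr)\biggr]^{-1}.$$ *)

(* Defs.v *)
From Stdlib Require Import Reals ZArith.
From Coquelicot Require Import Coquelicot.
Open Scope R_scope.

(* e(t) = exp(2 pi i t), through Euler's formula. *)
Definition e1 (t : R) : C := (cos (2 * PI * t), sin (2 * PI * t)).

Definition c1 (t : R) : R := cos (2 * PI * t).

(* The sum over the integers nu with |nu| < n is indexed by nu = k - n for
   k = 1, ..., 2 n - 1; it is empty when n = 0. *)
Definition trig_sum (n : nat) (a : Z -> C) (x : R) : C :=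
  sum_n_m (fun k : nat =>
             let nu := (Z.of_nat k - Z.of_nat n)%Z in
             Cmult (a nu) (e1 (IZR nu * x)))
          1 (2 * n - 1).

Definition real_trig_poly (n : nat) (t : R -> R) : Prop :=
  exists a : Z -> C, forall x : R, RtoC (t x) = trig_sum n a x.

Definition is_normC (t : R -> R) (M : R) : Prop :=
  (exists x : R, Rabs x <= 1 / 2 /\ Rabs (t x) = M) /\
  (forall x : R, Rabs x <= 1 / 2 -> Rabs (t x) <= M).

Definition normL (t : R -> R) : R :=
  RInt (fun x => Rabs (t x)) (- (1 / 2)) (1 / 2).

(* The supremum is taken in the extended reals, so that no finiteness
   of it is presupposed. *)
Definition Cn (n : nat) : Rbar :=
  Lub_Rbar (fun r : R =>
    exists (t : R -> R) (M : R),
      real_trig_poly n t /\ (exists x : R, t x <> 0) /\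
      is_normC t M /\ r = M / normL t).

Definition q1 : R := 1 / 4.
Definition q2 : R := 3 / 4.
Definition q3 : R := 5 / 4.

Definition omega_den (z : R) : R :=
  (q1 ^ 2 - z ^ 2) * (q2 ^ 2 - z ^ 2) * (q3 ^ 2 - z ^ 2).

Definition omega (z1 z2 z : R) : R :=
  (z1 ^ 2 - z ^ 2) * (z2 ^ 2 - z ^ 2) / omega_den z.

(* [Lim] is the limit over a punctured neighbourhood, so at the zeros
   z = +-q_k of the denominator it is the value given by continuity. *)
Definition phihat (z1 z2 z : R) : R :=
  if Req_EM_T (omega_den z) 0
  then real (Lim (fun y => omega z1 z2 y * c1 y) z)
  else omega z1 z2 z * c1 z.

Definition rho (z1 z2 : R) : R :=
  phihat z1 z2 0 *
  / (4 * (RInt (phihat z1 z2) 0 q1 + RInt (phihat z1 z2) q2 q3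
          - RInt (phihat z1 z2) z1 z2)).

Definition region (z1 z2 : R) : Prop :=
  1 / 2 < z1 < 1 /\ 1 < z2 < 3 / 2.

(* Main.v *)
From Stdlib Require Import Reals ZArith Lra Lia QArith Qabs Qreals List Ranalysis5.
From Coquelicot Require Import Coquelicot.
Require Import Defs.
Import ListNotations.
Open Scope R_scope.

(** Write [phihat = (z1^2 - z^2) (z2^2 - z^2) kernel(z)], where [kernel >= 0] on
  [[0, 3/2]].  On this interval [phihat] is negative exactly between [z1] and [z2], so
  [- int_z1^z2 phihat] only decreases when [z1, z2] are replaced, as limits of
  integration, by any other pair [x < 1 < y].  After the replacement the denominator of
  [rho] is linear in the coefficients of the even polynomial, hence it is a multiple of
  [phihat 0] as soon as the two equations [defect 1 x y = defect 2 x y = 0] hold, and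
  then [(x, y)] is a global maximum.  The two equations have a solution by the
  intermediate value theorem, and they locate it together with [rho x y] through
  certified Taylor expansions of the kernel at the points [q_k].

  For the lower bound on [Cn], put [X = cos (2 PI x)] and
  [t = cos (2 PI n x) (X - a1) (X - a2) / ((X - x1) (X - x2) (X - x3))] with
  [x_k = cos (2 PI q_k / n)], [a_i = cos (2 PI z_i / n)]; this is a cosine polynomial of
  degree less than [n].  To the right of [q3 / n] its sign is opposite to that of
  [cos (2 PI n x)], to whose sign [t] is orthogonal, so its norm in [L] is an integral
  over [[0, q3 / n]] only.  After rescaling, [t (z / n)] is proportional to [phihat z] up
  to a factor [1 + O(n^-2)], because [cos u - cos v] is [(v^2 - u^2) / 2] times two
  factors of the form [sin w / w]. *)

(** * Cosine polynomials *)

Fixpoint cos_sum (b : nat -> R) (n : nat) (x : R) : R :=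
  match n with
  | O => 0
  | S m => cos_sum b m x + b m * cos (2 * PI * (INR m * x))
  end.

Definition cos_term_primitive (k : nat) (x : R) : R :=
  match k with
  | O => x
  | S _ => sin (2 * PI * (INR k * x)) / (2 * PI * INR k)
  end.

Fixpoint cos_sum_primitive (b : nat -> R) (n : nat) (x : R) : R :=
  match n with
  | O => 0
  | S m => cos_sum_primitive b m x + b m * cos_term_primitive m x
  end.

Lemma cos_sum_even b n x : cos_sum b n (- x) = cos_sum b n x.
Proof.
induction n as [|n IH]; simpl; trivial.
rewrite IH. replace (2 * PI * (INR n * - x)) with (- (2 * PI * (INR n * x))) by ring.
now rewrite cos_neg.
Qed.

Lemma cos_sum_plus b b' n x :
  cos_sum (fun k => b k + b' k) n x = cos_sum b n x + cos_sum b' n x.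
Proof. induction n as [|n IH]; simpl; [ring|]. rewrite IH; ring. Qed.

Lemma cos_sum_scal r b n x :
  cos_sum (fun k => r * b k) n x = r * cos_sum b n x.
Proof. induction n as [|n IH]; simpl; [ring|]. rewrite IH; ring. Qed.

Lemma is_derive_cos_sum_primitive b n x :
  is_derive (cos_sum_primitive b n) x (cos_sum b n x).
Proof.
induction n as [|n IH]; simpl.
  exact (is_derive_const 0 x).
apply (is_derive_plus (cos_sum_primitive b n) (fun x => b n * cos_term_primitive n x)); trivial.
apply is_derive_scal.
destruct n as [|n].
  simpl. replace (2 * PI * (0 * x)) with 0 by ring. rewrite cos_0.
  exact (is_derive_id x).
unfold cos_term_primitive.
assert (HP := PI_RGT_0). assert (Hn : 0 < INR (S n)) by (apply lt_0_INR; lia).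
revert Hn. generalize (INR (S n)) as k. intros k Hk.
auto_derive; trivial. field. lra.
Qed.

Lemma continuous_cos_sum b n x : continuous (cos_sum b n) x.
Proof.
induction n as [|n IH]; simpl.
  apply continuous_const.
apply (continuous_plus (cos_sum b n) (fun x => b n * cos (2 * PI * (INR n * x)))); trivial.
apply (ex_derive_continuous (fun x0 : R => b n * cos (2 * PI * (INR n * x0)))).
auto_derive; trivial.
Qed.

Lemma cos_sum_RInt b n x y :
  is_RInt (cos_sum b n) x y (cos_sum_primitive b n y - cos_sum_primitive b n x).
Proof.
apply (is_RInt_derive (cos_sum_primitive b n) (cos_sum b n)).
  intros; apply is_derive_cos_sum_primitive.
intros; apply continuous_cos_sum.
Qed.

Lemma cos_sum_primitive_0 b n : cos_sum_primitive b n 0 = 0.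
Proof.
induction n as [|n IH]; simpl; trivial. rewrite IH.
destruct n; simpl; [ring|]. rewrite !Rmult_0_r, sin_0. unfold Rdiv. ring.
Qed.

Definition cos_coef (b : nat -> R) (nu : Z) : C :=
  RtoC (match nu with Z0 => b O | _ => b (Z.abs_nat nu) / 2 end).

(** Raising the bound on the degree by one shifts the index [k] by one and adds two outermost
    frequencies of opposite sign. Their half coefficients and conjugate exponentials combine into
    one cosine. *)
Lemma cos_sum_real_trig_poly b n : real_trig_poly n (cos_sum b n).
Proof.
exists (cos_coef b). intros x. induction n as [|n IH].
  unfold trig_sum. rewrite sum_n_m_zero by (simpl; lia). reflexivity.
destruct n as [|n].
  unfold trig_sum. simpl. rewrite sum_n_n. simpl.
  unfold cos_coef, e1, RtoC, Cmult; simpl.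
  rewrite !Rmult_0_l, !Rmult_0_r, cos_0, sin_0. f_equal; ring.
unfold trig_sum in *.
replace (2 * S (S n) - 1)%nat with (S (S (2 * S n - 1))) by lia.
rewrite sum_Sn_m, sum_n_Sm by lia.
rewrite <- sum_n_m_S.
rewrite (sum_n_m_ext _ (fun k : nat =>
             let nu := (Z.of_nat k - Z.of_nat (S n))%Z in
             Cmult (cos_coef b nu) (e1 (IZR nu * x)))).
2: { intros k. replace (Z.of_nat (S k) - Z.of_nat (S (S n)))%Z with
     (Z.of_nat k - Z.of_nat (S n))%Z by lia. reflexivity. }
cbv zeta in IH |- *. rewrite <- IH.
replace (Z.of_nat 1 - Z.of_nat (S (S n)))%Z with (- Z.of_nat (S n))%Z by lia.
replace (Z.of_nat (S (S (2 * S n - 1))) - Z.of_nat (S (S n)))%Z with (Z.of_nat (S n)) by lia.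
unfold cos_coef at 1 2, e1.
rewrite opp_IZR, <- INR_IZR_INZ.
replace (2 * PI * (- INR (S n) * x)) with (- (2 * PI * (INR (S n) * x))) by ring.
rewrite cos_neg, sin_neg.
change (cos_sum b (S (S n)) x) with
  (cos_sum b (S n) x + b (S n) * cos (2 * PI * (INR (S n) * x))).
assert (Ea : Z.abs_nat (- Z.of_nat (S n)) = S n) by lia.
assert (Eb : Z.abs_nat (Z.of_nat (S n)) = S n) by lia.
revert Ea Eb.
(* With the two frequencies exhibited as [Zneg] and [Zpos], the [match] in [cos_coef] reduces. *)
change (- Z.of_nat (S n))%Z with (Zneg (Pos.of_succ_nat n)).
change (Z.of_nat (S n)) with (Zpos (Pos.of_succ_nat n)).
cbv iota. intros -> ->.
unfold RtoC, Cmult, plus; simpl. unfold Cplus; simpl. f_equal; field.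
Qed.

(* Coefficients of [(cos (2 PI n x) - cos (n y)) / (cos (2 PI x) - cos y)]. *)
Definition cos_quot_coef (n : nat) (y : R) (k : nat) : R :=
  match k with
  | O => sin (INR n * y) / sin y
  | S _ => 2 * sin ((INR n - INR k) * y) / sin y
  end.

(** A telescoping of Christoffel-Darboux type. The factor [cos (2 PI x) - cos y] sends every cosine
    to its neighbours, and the recurrence satisfied by [sin ((n - k) y)] cancels everything except
    the boundary terms. *)
Lemma cos_quot_partial (n : nat) (y : R) (m : nat) (x : R) : sin y <> 0 ->
  (cos (2 * PI * x) - cos y) * cos_sum (cos_quot_coef n y) (S m) x =
  (sin ((INR n - INR m) * y) * cos (2 * PI * (INR (S m) * x))
   - sin ((INR n - INR (S m)) * y) * cos (2 * PI * (INR m * x))) / sin y - cos (INR n * y).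
Proof.
intros Hy. induction m as [|m IH].
  simpl. rewrite !Rmult_0_l, !Rmult_0_r, cos_0, Rmult_1_l, Rminus_0_r.
  replace ((INR n - 1) * y) with (INR n * y - y) by ring. rewrite sin_minus.
  field; trivial.
change (cos_sum (cos_quot_coef n y) (S (S m)) x) with
  (cos_sum (cos_quot_coef n y) (S m) x + cos_quot_coef n y (S m) * cos (2 * PI * (INR (S m) * x))).
rewrite Rmult_plus_distr_l, IH. unfold cos_quot_coef.
rewrite (S_INR (S m)).
replace (INR m) with (INR (S m) - 1) by (rewrite S_INR; ring).
set (N := INR n). set (k := INR (S m)).
replace ((N - (k - 1)) * y) with ((N - k) * y + y) by ring.
replace ((N - (k + 1)) * y) with ((N - k) * y - y) by ring.
replace (2 * PI * ((k + 1) * x)) with (2 * PI * (k * x) + 2 * PI * x) by ring.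
replace (2 * PI * ((k - 1) * x)) with (2 * PI * (k * x) - 2 * PI * x) by ring.
rewrite sin_plus, sin_minus, cos_plus, cos_minus.
field; trivial.
Qed.

(** At the last index [m = n - 1] one boundary sine is [sin y] and the other vanishes. *)
Lemma cos_quot (n : nat) (y x : R) : (1 <= n)%nat -> sin y <> 0 ->
  (cos (2 * PI * x) - cos y) * cos_sum (cos_quot_coef n y) n x =
  cos (2 * PI * (INR n * x)) - cos (INR n * y).
Proof.
intros Hn Hy. destruct n as [|m]; [lia|].
rewrite cos_quot_partial by trivial.
rewrite Rminus_diag, Rmult_0_l, sin_0.
replace ((INR (S m) - INR m) * y) with y by (rewrite S_INR; ring).
field; trivial.
Qed.

(** * Orthogonality to the sign of [cos (2 PI n x)] *)

Fixpoint alt_sum (f : nat -> R) (n : nat) : R :=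
  match n with O => 0 | S m => alt_sum f m + (-1) ^ m * f m end.

(* Abscissae of the zeros of [cos (2 PI n x)] on [0 < x < 1/2] *)
Definition node (n j : nat) : R := (2 * INR j + 1) / (4 * INR n).

Lemma alt_sum_plus f g n : alt_sum (fun k => f k + g k) n = alt_sum f n + alt_sum g n.
Proof. induction n as [|n IH]; simpl; [ring|]. rewrite IH; ring. Qed.

Lemma alt_sum_scal r f n : alt_sum (fun k => r * f k) n = r * alt_sum f n.
Proof. induction n as [|n IH]; simpl; [ring|]. rewrite IH; ring. Qed.

Lemma alt_sum_odd m : 2 * alt_sum (fun j => 2 * INR j + 1) m = - 2 * INR m * (-1) ^ m.
Proof.
induction m as [|m IH]; [simpl; ring|].
change (alt_sum ?f (S m)) with (alt_sum f m + (-1) ^ m * f m).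
rewrite Rmult_plus_distr_l, IH, S_INR. simpl. ring.
Qed.

(** Since [2 cos al sin ((2 j + 1) al) = sin ((2 j + 2) al) + sin (2 j al)], the alternating sum
    telescopes after multiplication by [2 cos al]. *)
Lemma alt_sum_sin al m :
  2 * cos al * alt_sum (fun j => sin ((2 * INR j + 1) * al)) m = - (-1) ^ m * sin (2 * INR m * al).
Proof.
induction m as [|m IH]; [simpl; rewrite ?Rmult_0_r, ?Rmult_0_l, sin_0; ring|].
change (alt_sum ?f (S m)) with (alt_sum f m + (-1) ^ m * f m).
rewrite Rmult_plus_distr_l, IH, S_INR.
replace (2 * INR m * al) with ((2 * INR m + 1) * al - al) by ring.
replace (2 * (INR m + 1) * al) with ((2 * INR m + 1) * al + al) by ring.
rewrite sin_minus, sin_plus. simpl. ring.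
Qed.

Lemma sin_INR_PI k : sin (INR k * PI) = 0.
Proof. apply sin_eq_0_1. exists (Z.of_nat k). now rewrite <- INR_IZR_INZ. Qed.

(* Orthogonality of the cosines of frequency less than [n] to the sign of
   [cos (2 PI n x)], written on the primitives. *)
Lemma cos_term_orthogonality (n k : nat) : (k < n)%nat ->
  2 * alt_sum (fun j => cos_term_primitive k (node n j)) n
  = - (-1) ^ n * cos_term_primitive k (1 / 2).
Proof.
intros Hk. assert (Hn : 0 < INR n) by (apply lt_0_INR; lia).
assert (HP := PI_RGT_0). destruct k as [|k].
  simpl. unfold node.
  assert (E : alt_sum (fun j => (2 * INR j + 1) / (4 * INR n)) n =
     / (4 * INR n) * alt_sum (fun j => 2 * INR j + 1) n).
    rewrite <- alt_sum_scal. clear. generalize (INR n) as r. induction n as [|n IH]; intros r; simpl; trivial.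
    rewrite IH. unfold Rdiv. ring.
  rewrite E. assert (A := alt_sum_odd n).
  replace (2 * (/ (4 * INR n) * alt_sum (fun j : nat => 2 * INR j + 1) n))
    with (/ (4 * INR n) * (2 * alt_sum (fun j : nat => 2 * INR j + 1) n)) by ring.
  rewrite A. field. lra.
unfold cos_term_primitive.
set (K := INR (S k)). assert (HK : 0 < K) by (apply lt_0_INR; lia).
assert (HKn : K < INR n) by (apply lt_INR; lia).
set (al := PI * K / (2 * INR n)).
assert (E : alt_sum (fun j => sin (2 * PI * (K * node n j)) / (2 * PI * K)) n =
   / (2 * PI * K) * alt_sum (fun j => sin ((2 * INR j + 1) * al)) n).
  rewrite <- alt_sum_scal. unfold node, al. revert Hn. generalize (INR n) as r. clear.
  intros r Hr. induction n as [|n IH]; simpl; trivial. rewrite IH. f_equal. f_equal.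
  unfold Rdiv at 1. rewrite Rmult_comm. f_equal. f_equal. field. lra.
rewrite E.
assert (A := alt_sum_sin al n).
(* A frequency below [n] puts [al] in [(0, PI / 2)], so the telescoped identity, whose right-hand
   side is a multiple of [sin (K PI) = 0], can be divided by [2 cos al]. *)
assert (Hc : 0 < cos al).
  apply cos_gt_0.
    assert (0 < al); [|lra]. unfold al. apply Rdiv_lt_0_compat; nra.
  unfold al. apply (Rmult_lt_reg_r (2 * INR n)); [lra|].
  replace (PI * K / (2 * INR n) * (2 * INR n)) with (PI * K) by (field; lra).
  replace (PI / 2 * (2 * INR n)) with (PI * INR n) by field. nra.
replace (2 * INR n * al) with (INR (S k) * PI) in A by (unfold al, K; field; lra).
rewrite sin_INR_PI, Rmult_0_r in A.
assert (Z : alt_sum (fun j : nat => sin ((2 * INR j + 1) * al)) n = 0).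
  apply Rmult_integral in A. destruct A as [A|A]; trivial. lra.
rewrite Z.
replace (2 * PI * (K * (1 / 2))) with (INR (S k) * PI) by (unfold K; field).
rewrite sin_INR_PI. unfold Rdiv; ring.
Qed.

(** The length [m] of the sum is kept apart from the [n] of the nodes, so that the induction on [m]
    leaves the nodes fixed. *)
Lemma cos_sum_orthogonality (b : nat -> R) (n m : nat) : (m <= n)%nat ->
  2 * alt_sum (fun j => cos_sum_primitive b m (node n j)) n
  = - (-1) ^ n * cos_sum_primitive b m (1 / 2).
Proof.
induction m as [|m IH]; intros Hm.
  simpl. assert (E : alt_sum (fun _ => 0) n = 0) by (clear; induction n; simpl; lra).
  rewrite E; ring.
simpl. rewrite alt_sum_plus, alt_sum_scal, Rmult_plus_distr_l, IH by lia.
replace (2 * (b m * alt_sum (fun k : nat => cos_term_primitive m (node n k)) n)) with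
 (b m * (2 * alt_sum (fun k : nat => cos_term_primitive m (node n k)) n)) by ring.
rewrite cos_term_orthogonality by lia. ring.
Qed.

Lemma cos_add_INR_PI k x : cos (x + INR k * PI) = (-1) ^ k * cos x.
Proof.
induction k as [|k IH]; [simpl; rewrite Rmult_0_l, Rplus_0_r; ring|].
rewrite S_INR. replace (x + (INR k + 1) * PI) with (x + INR k * PI + PI) by ring.
rewrite neg_cos, IH. simpl; ring.
Qed.

(** Subtracting [(j + 1) PI] brings the argument into [(-PI / 2, PI / 2)]. *)
Lemma cos_sign_between_nodes n j x : (0 < n)%nat -> node n j < x < node n (S j) ->
  0 < (-1) ^ S j * cos (2 * PI * (INR n * x)).
Proof.
intros Hn [H1 H2]. assert (Hr : 0 < INR n) by now apply lt_0_INR.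
assert (HP := PI_RGT_0).
replace (2 * PI * (INR n * x)) with (2 * PI * (INR n * x) - INR (S j) * PI + INR (S j) * PI) by ring.
rewrite cos_add_INR_PI, <- Rmult_assoc, <- Rpow_mult_distr.
replace (-1 * -1) with 1 by ring. rewrite pow1, Rmult_1_l.
unfold node in *.
assert (A : 2 * INR j + 1 < 4 * INR n * x).
  apply (Rmult_lt_compat_l (4 * INR n)) in H1; [|lra].
  replace (4 * INR n * ((2 * INR j + 1) / (4 * INR n))) with (2 * INR j + 1) in H1 by (field; lra). lra.
assert (B : 4 * INR n * x < 2 * INR (S j) + 1).
  apply (Rmult_lt_compat_l (4 * INR n)) in H2; [|lra].
  replace (4 * INR n * ((2 * INR (S j) + 1) / (4 * INR n))) with (2 * INR (S j) + 1) in H2 by (field; lra). lra.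
rewrite S_INR in *. apply cos_gt_0; nra.
Qed.

Lemma cos_2PI_decr x y : 0 <= x -> x < y -> y <= 1 / 2 -> cos (2 * PI * y) < cos (2 * PI * x).
Proof. intros. assert (HP := PI_RGT_0). apply cos_decreasing_1; nra. Qed.

Lemma node_lt n i j : (0 < n)%nat -> (i < j)%nat -> node n i < node n j.
Proof.
intros Hn Hij. apply lt_0_INR in Hn. apply lt_INR in Hij. unfold node.
apply Rmult_lt_compat_r; [apply Rinv_0_lt_compat; lra|lra].
Qed.

Lemma node_pos n j : (0 < n)%nat -> 0 < node n j.
Proof.
intros Hn. apply lt_0_INR in Hn. assert (H := pos_INR j). unfold node.
apply Rdiv_lt_0_compat; lra.
Qed.

Lemma node_lt_half n j : (j < n)%nat -> node n j < 1 / 2.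
Proof.
intros Hj. assert (Hn : 0 < INR n) by (apply lt_0_INR; lia).
assert (INR j + 1 <= INR n) by (rewrite <- S_INR; apply le_INR; lia).
unfold node. apply (Rmult_lt_reg_r (4 * INR n)); [lra|].
unfold Rdiv. rewrite Rmult_assoc, Rinv_l; lra.
Qed.

(** * Interpolation by a cosine polynomial with prescribed zeros *)

Definition cos_gap (x y : R) : R := cos (2 * PI * x) - cos (2 * PI * y).

(* The discrete analogue of the function phihat: [t] vanishes at the nodes
   other than the first three, and at [zeta1], [zeta2]. *)
Definition discrete_phihat (n : nat) (zeta1 zeta2 : R) (t : R -> R) : Prop :=
  forall x, t x * (cos_gap x (node n 0) * cos_gap x (node n 1) * cos_gap x (node n 2)) =
    cos (2 * PI * (INR n * x)) * (cos_gap x zeta1 * cos_gap x zeta2).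

(** Lagrange interpolation of a quadratic at three points. Divided by [(X - u) (X - v) (X - w)], it
    is the partial fraction decomposition of the rational factor of [t]. *)
Lemma lagrange_three (X a b u v w : R) : u <> v -> u <> w -> v <> w ->
  (u - a) * (u - b) / ((u - v) * (u - w)) * ((X - v) * (X - w)) +
  (v - a) * (v - b) / ((v - u) * (v - w)) * ((X - u) * (X - w)) +
  (w - a) * (w - b) / ((w - u) * (w - v)) * ((X - u) * (X - v)) = (X - a) * (X - b).
Proof. intros. field. repeat split; lra. Qed.

Lemma cos_node n j : (0 < n)%nat -> cos (INR n * (2 * PI * node n j)) = 0.
Proof.
intros Hn. apply lt_0_INR in Hn. unfold node.
replace (INR n * (2 * PI * ((2 * INR j + 1) / (4 * INR n)))) with (PI / 2 + INR j * PI) by (field; lra).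
rewrite cos_add_INR_PI, cos_PI2. ring.
Qed.

(** Each partial fraction times [cos (2 PI n x)] is a cosine polynomial by [cos_quot], because
    [cos (n y)] vanishes at the nodes. The bound [3 <= n] puts the first three nodes in [(0, 1/2)],
    where their cosines are distinct and their sines nonzero. *)
Lemma discrete_phihat_exists n zeta1 zeta2 : (3 <= n)%nat ->
  exists b, discrete_phihat n zeta1 zeta2 (cos_sum b n).
Proof.
intros Hn. assert (HP := PI_RGT_0).
set (y := fun j => 2 * PI * node n j).
assert (Hy : forall j, (j < 3)%nat -> sin (y j) <> 0).
{ intros j Hj. apply Rgt_not_eq, Rlt_gt. assert (A := node_pos n j ltac:(lia)).
  assert (B := node_lt_half n j ltac:(lia)). apply sin_gt_0; unfold y; nra. }
assert (Hc : forall i j, (i < j)%nat -> (j < 3)%nat -> cos (y j) < cos (y i)).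
{ intros i j Hi Hj. apply cos_2PI_decr.
    apply Rlt_le, node_pos; lia. apply node_lt; lia. apply Rlt_le, node_lt_half; lia. }
set (a1 := cos (2 * PI * zeta1)). set (a2 := cos (2 * PI * zeta2)).
set (u := cos (y 0%nat)). set (v := cos (y 1%nat)). set (w := cos (y 2%nat)).
assert (v < u) by (apply Hc; lia). assert (w < u) by (apply Hc; lia).
assert (w < v) by (apply Hc; lia).
set (B0 := (u - a1) * (u - a2) / ((u - v) * (u - w))).
set (B1 := (v - a1) * (v - a2) / ((v - u) * (v - w))).
set (B2 := (w - a1) * (w - a2) / ((w - u) * (w - v))).
exists (fun k => (B0 * cos_quot_coef n (y 0%nat) k + B1 * cos_quot_coef n (y 1%nat) k)
   + B2 * cos_quot_coef n (y 2%nat) k).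
intros x. rewrite (cos_sum_plus (fun k => B0 * cos_quot_coef n (y 0%nat) k + B1 * cos_quot_coef n (y 1%nat) k)).
rewrite cos_sum_plus, !cos_sum_scal. unfold cos_gap.
assert (Q : forall j, (j < 3)%nat -> (cos (2 * PI * x) - cos (y j)) * cos_sum (cos_quot_coef n (y j)) n x
   = cos (2 * PI * (INR n * x))).
{ intros j Hj. rewrite cos_quot by (auto; lia). unfold y. rewrite cos_node by lia. ring. }
assert (Q0 := Q 0%nat ltac:(lia)). assert (Q1 := Q 1%nat ltac:(lia)). assert (Q2 := Q 2%nat ltac:(lia)).
fold (y 0%nat) (y 1%nat) (y 2%nat). fold a1 a2. fold u v w in Q0, Q1, Q2 |- *.
set (X := cos (2 * PI * x)) in *. set (c := cos (2 * PI * (INR n * x))) in *.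
rewrite <- (lagrange_three X a1 a2 u v w) by lra.
fold B0 B1 B2.
set (D0 := cos_sum (cos_quot_coef n (y 0%nat)) n x) in *.
set (D1 := cos_sum (cos_quot_coef n (y 1%nat)) n x) in *.
set (D2 := cos_sum (cos_quot_coef n (y 2%nat)) n x) in *.
transitivity (B0 * (((X - u) * D0) * ((X - v) * (X - w))) + B1 * (((X - v) * D1) * ((X - u) * (X - w)))
  + B2 * (((X - w) * D2) * ((X - u) * (X - v)))); [ring|].
rewrite Q0, Q1, Q2. ring.
Qed.

Lemma is_RInt_abs_constant_sign (f : R -> R) (s a b I : R) : a <= b -> Rabs s = 1 ->
  (forall x, a < x < b -> 0 <= s * f x) -> is_RInt f a b I ->
  is_RInt (fun x => Rabs (f x)) a b (s * I).
Proof.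
intros Hab Hs H HI. apply (is_RInt_ext (fun x => s * f x)).
  rewrite Rmin_left, Rmax_right by trivial. intros x Hx.
  rewrite <- (Rabs_pos_eq (s * f x)) by now apply H. rewrite Rabs_mult, Hs. apply Rmult_1_l.
exact (is_RInt_scal f a b s I HI).
Qed.

(** Multiplying [t = c N / P] by the positive number [P^2] gives [c N P], a product whose sign can
    be read off factor by factor. *)
Lemma sign_of_quotient (t P c N s : R) : t * P = c * N -> P <> 0 -> 0 <= s * (c * (N * P)) -> 0 <= s * t.
Proof.
intros E HP H. assert (0 < P * P) by nra.
apply (Rmult_le_reg_r (P * P)); trivial. rewrite Rmult_0_l.
replace (s * t * (P * P)) with (s * ((t * P) * P)) by ring. rewrite E. 
replace (s * (c * N * P)) with (s * (c * (N * P))) by ring. trivial.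
Qed.

Lemma cos_gap_pos x y : 0 <= x -> x < y -> y <= 1 / 2 -> 0 < cos_gap x y.
Proof. intros. unfold cos_gap. assert (A := cos_2PI_decr x y). lra. Qed.

Lemma cos_gap_neg x y : 0 <= y -> y < x -> x <= 1 / 2 -> cos_gap x y < 0.
Proof. intros. unfold cos_gap. assert (A := cos_2PI_decr y x). lra. Qed.

(** * The norm in [L] of the interpolating polynomial *)

Section DiscreteNorm.

Variables (n : nat) (zeta1 zeta2 : R) (b : nat -> R).
Hypothesis Hn : (3 <= n)%nat.
Hypothesis Hz1 : node n 0 < zeta1 < node n 1.
Hypothesis Hz2 : node n 1 < zeta2 < node n 2.
Hypothesis Ht : discrete_phihat n zeta1 zeta2 (cos_sum b n).

Let t := cos_sum b n.
Let F := cos_sum_primitive b n.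
Let p := node n.

Let Hn0 : (0 < n)%nat. Proof. lia. Qed.
Let p0_pos : 0 < p 0%nat := node_pos n 0 Hn0.
Let p2_half : p 2%nat < 1 / 2 := node_lt_half n 2 Hn.

Lemma discrete_phihat_sign s x :
  cos_gap x (p 0%nat) <> 0 -> cos_gap x (p 1%nat) <> 0 -> cos_gap x (p 2%nat) <> 0 ->
  0 <= s * (cos (2 * PI * (INR n * x)) *
   ((cos_gap x zeta1 * cos_gap x zeta2) * (cos_gap x (p 0%nat) * cos_gap x (p 1%nat) * cos_gap x (p 2%nat)))) ->
  0 <= s * t x.
Proof.
intros A0 A1 A2 A. eapply sign_of_quotient; [exact (Ht x)| |exact A].
repeat apply Rmult_integral_contrapositive_currified; trivial.
Qed.

Lemma abs_int_piece s a c : Rabs s = 1 -> a <= c -> (forall x, a < x < c -> 0 <= s * t x) ->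
  is_RInt (fun x => Rabs (t x)) a c (s * (F c - F a)).
Proof. intros. apply is_RInt_abs_constant_sign; trivial. apply cos_sum_RInt. Qed.

(** At [p 0] and [p 1] the cosine changes sign together with a factor of the denominator, so [t]
    changes sign only at [zeta1] and [zeta2]. The interval is nevertheless cut at these nodes as
    well, since the quotient formula does not determine [t] there. *)
Lemma abs_int_head : is_RInt (fun x => Rabs (t x)) 0 (p 2%nat) (2 * F zeta1 - 2 * F zeta2 + F (p 2%nat)).
Proof.
assert (F0 : F 0 = 0) by apply cos_sum_primitive_0.
assert (HP := PI_RGT_0). assert (Hr : 0 < INR n) by now apply lt_0_INR.
assert (R1 : Rabs 1 = 1) by apply Rabs_R1.
assert (R2 : Rabs (-1) = 1) by (rewrite Rabs_left; lra).
fold (p 0%nat) (p 1%nat) in Hz1. fold (p 1%nat) (p 2%nat) in Hz2.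
assert (I1 : is_RInt (fun x => Rabs (t x)) 0 (p 0%nat) (1 * (F (p 0%nat) - F 0))).
{ apply abs_int_piece; [trivial|lra|]. intros x Hx.
  assert (B0 := cos_gap_pos x (p 0%nat) ltac:(lra) ltac:(lra) ltac:(lra)). assert (B1 := cos_gap_pos x (p 1%nat) ltac:(lra) ltac:(lra) ltac:(lra)).
  assert (B2 := cos_gap_pos x (p 2%nat) ltac:(lra) ltac:(lra) ltac:(lra)). assert (B3 := cos_gap_pos x zeta1 ltac:(lra) ltac:(lra) ltac:(lra)).
  assert (B4 := cos_gap_pos x zeta2 ltac:(lra) ltac:(lra) ltac:(lra)).
  apply discrete_phihat_sign; try lra.
  assert (C : 0 < cos (2 * PI * (INR n * x))).
  { destruct Hx as [Hx1 Hx2]. unfold p, node in Hx2. simpl INR in Hx2.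
    apply (Rmult_lt_compat_l (4 * INR n)) in Hx2; [|lra].
    replace (4 * INR n * ((2 * 0 + 1) / (4 * INR n))) with 1 in Hx2 by (field; lra).
    assert (0 < INR n * x) by (apply Rmult_lt_0_compat; lra).
    apply cos_gt_0; nra. }
  rewrite Rmult_1_l. repeat apply Rmult_le_pos; lra. }
assert (I2 : is_RInt (fun x => Rabs (t x)) (p 0%nat) zeta1 (1 * (F zeta1 - F (p 0%nat)))).
{ apply abs_int_piece; [trivial|lra|]. intros x Hx.
  assert (B0 := cos_gap_neg x (p 0%nat) ltac:(lra) ltac:(lra) ltac:(lra)). assert (B1 := cos_gap_pos x (p 1%nat) ltac:(lra) ltac:(lra) ltac:(lra)).
  assert (B2 := cos_gap_pos x (p 2%nat) ltac:(lra) ltac:(lra) ltac:(lra)). assert (B3 := cos_gap_pos x zeta1 ltac:(lra) ltac:(lra) ltac:(lra)).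
  assert (B4 := cos_gap_pos x zeta2 ltac:(lra) ltac:(lra) ltac:(lra)).
  apply discrete_phihat_sign; try lra.
  assert (C := cos_sign_between_nodes n 0 x Hn0 ltac:(fold (p 0%nat) (p 1%nat) (p 2%nat); lra)). fold (p 0%nat) (p 1%nat) in C. simpl pow in C.
  replace (1 * (cos (2 * PI * (INR n * x)) * (cos_gap x zeta1 * cos_gap x zeta2 *
    (cos_gap x (p 0%nat) * cos_gap x (p 1%nat) * cos_gap x (p 2%nat))))) with
   ((- cos (2 * PI * (INR n * x))) * (cos_gap x zeta1 * cos_gap x zeta2 *
    ((- cos_gap x (p 0%nat)) * cos_gap x (p 1%nat) * cos_gap x (p 2%nat)))) by ring.
  repeat apply Rmult_le_pos; lra. }
assert (I3 : is_RInt (fun x => Rabs (t x)) zeta1 (p 1%nat) (-1 * (F (p 1%nat) - F zeta1))).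
{ apply abs_int_piece; [trivial|lra|]. intros x Hx.
  assert (B0 := cos_gap_neg x (p 0%nat) ltac:(lra) ltac:(lra) ltac:(lra)). assert (B1 := cos_gap_pos x (p 1%nat) ltac:(lra) ltac:(lra) ltac:(lra)).
  assert (B2 := cos_gap_pos x (p 2%nat) ltac:(lra) ltac:(lra) ltac:(lra)). assert (B3 := cos_gap_neg x zeta1 ltac:(lra) ltac:(lra) ltac:(lra)).
  assert (B4 := cos_gap_pos x zeta2 ltac:(lra) ltac:(lra) ltac:(lra)).
  apply discrete_phihat_sign; try lra.
  assert (C := cos_sign_between_nodes n 0 x Hn0 ltac:(fold (p 0%nat) (p 1%nat) (p 2%nat); lra)). fold (p 0%nat) (p 1%nat) in C. simpl pow in C.
  replace (-1 * (cos (2 * PI * (INR n * x)) * (cos_gap x zeta1 * cos_gap x zeta2 *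
    (cos_gap x (p 0%nat) * cos_gap x (p 1%nat) * cos_gap x (p 2%nat))))) with
   ((- cos (2 * PI * (INR n * x))) * ((- cos_gap x zeta1) * cos_gap x zeta2 *
    ((- cos_gap x (p 0%nat)) * cos_gap x (p 1%nat) * cos_gap x (p 2%nat)))) by ring.
  repeat apply Rmult_le_pos; lra. }
assert (I4 : is_RInt (fun x => Rabs (t x)) (p 1%nat) zeta2 (-1 * (F zeta2 - F (p 1%nat)))).
{ apply abs_int_piece; [trivial|lra|]. intros x Hx.
  assert (B0 := cos_gap_neg x (p 0%nat) ltac:(lra) ltac:(lra) ltac:(lra)). assert (B1 := cos_gap_neg x (p 1%nat) ltac:(lra) ltac:(lra) ltac:(lra)).
  assert (B2 := cos_gap_pos x (p 2%nat) ltac:(lra) ltac:(lra) ltac:(lra)). assert (B3 := cos_gap_neg x zeta1 ltac:(lra) ltac:(lra) ltac:(lra)).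
  assert (B4 := cos_gap_pos x zeta2 ltac:(lra) ltac:(lra) ltac:(lra)).
  apply discrete_phihat_sign; try lra.
  assert (C := cos_sign_between_nodes n 1 x Hn0 ltac:(fold (p 0%nat) (p 1%nat) (p 2%nat); lra)). fold (p 1%nat) (p 2%nat) in C. simpl pow in C.
  replace (-1 * (cos (2 * PI * (INR n * x)) * (cos_gap x zeta1 * cos_gap x zeta2 *
    (cos_gap x (p 0%nat) * cos_gap x (p 1%nat) * cos_gap x (p 2%nat))))) with
   (cos (2 * PI * (INR n * x)) * ((- cos_gap x zeta1) * cos_gap x zeta2 *
    ((- cos_gap x (p 0%nat)) * (- cos_gap x (p 1%nat)) * cos_gap x (p 2%nat)))) by ring.
  repeat apply Rmult_le_pos; lra. }
assert (I5 : is_RInt (fun x => Rabs (t x)) zeta2 (p 2%nat) (1 * (F (p 2%nat) - F zeta2))).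
{ apply abs_int_piece; [trivial|lra|]. intros x Hx.
  assert (B0 := cos_gap_neg x (p 0%nat) ltac:(lra) ltac:(lra) ltac:(lra)). assert (B1 := cos_gap_neg x (p 1%nat) ltac:(lra) ltac:(lra) ltac:(lra)).
  assert (B2 := cos_gap_pos x (p 2%nat) ltac:(lra) ltac:(lra) ltac:(lra)). assert (B3 := cos_gap_neg x zeta1 ltac:(lra) ltac:(lra) ltac:(lra)).
  assert (B4 := cos_gap_neg x zeta2 ltac:(lra) ltac:(lra) ltac:(lra)).
  apply discrete_phihat_sign; try lra.
  assert (C := cos_sign_between_nodes n 1 x Hn0 ltac:(fold (p 0%nat) (p 1%nat) (p 2%nat); lra)). fold (p 1%nat) (p 2%nat) in C. simpl pow in C.
  replace (1 * (cos (2 * PI * (INR n * x)) * (cos_gap x zeta1 * cos_gap x zeta2 *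
    (cos_gap x (p 0%nat) * cos_gap x (p 1%nat) * cos_gap x (p 2%nat))))) with
   (cos (2 * PI * (INR n * x)) * ((- cos_gap x zeta1) * (- cos_gap x zeta2) *
    ((- cos_gap x (p 0%nat)) * (- cos_gap x (p 1%nat)) * cos_gap x (p 2%nat)))) by ring.
  repeat apply Rmult_le_pos; lra. }
assert (J := is_RInt_Chasles _ _ _ _ _ _ (is_RInt_Chasles _ _ _ _ _ _ (is_RInt_Chasles _ _ _ _ _ _
  (is_RInt_Chasles _ _ _ _ _ _ I1 I2) I3) I4) I5).
match type of J with is_RInt _ _ _ ?v => replace (2 * F zeta1 - 2 * F zeta2 + F (p 2%nat)) with v; trivial end.
unfold plus; simpl. rewrite F0. ring.
Qed.

(** Past [p 2] all five gaps are negative, so [t] has the sign opposite to the cosine. The condition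
    [x <= 1 / 2] matters for [j = n - 1], as the node [p n] exceeds [1 / 2]. *)
Lemma discrete_phihat_tail_sign j x : (2 <= j)%nat -> p j < x < p (S j) -> x <= 1 / 2 ->
  0 <= (-1) ^ j * t x.
Proof.
intros Hj Hx Hh.
assert (p 2%nat <= p j).
  { destruct (Nat.eq_dec j 2) as [->|]; [lra|]. apply Rlt_le, node_lt; lia. }
fold (p 0%nat) (p 1%nat) in Hz1. fold (p 1%nat) (p 2%nat) in Hz2.
assert (B0 := cos_gap_neg x (p 0%nat) ltac:(lra) ltac:(lra) ltac:(lra)). assert (B1 := cos_gap_neg x (p 1%nat) ltac:(lra) ltac:(lra) ltac:(lra)).
assert (B2 := cos_gap_neg x (p 2%nat) ltac:(lra) ltac:(lra) ltac:(lra)). assert (B3 := cos_gap_neg x zeta1 ltac:(lra) ltac:(lra) ltac:(lra)).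
assert (B4 := cos_gap_neg x zeta2 ltac:(lra) ltac:(lra) ltac:(lra)).
apply discrete_phihat_sign; try lra.
assert (C := cos_sign_between_nodes n j x Hn0 Hx). simpl pow in C.
replace ((-1) ^ j * (cos (2 * PI * (INR n * x)) * (cos_gap x zeta1 * cos_gap x zeta2 *
    (cos_gap x (p 0%nat) * cos_gap x (p 1%nat) * cos_gap x (p 2%nat))))) with
   (-1 * (-1) ^ j * cos (2 * PI * (INR n * x)) * ((- cos_gap x zeta1) * (- cos_gap x zeta2) *
    ((- cos_gap x (p 0%nat)) * (- cos_gap x (p 1%nat)) * (- cos_gap x (p 2%nat))))) by ring.
apply Rmult_le_pos; [lra|repeat apply Rmult_le_pos; lra].
Qed.

Lemma Rabs_pow_m1 k : Rabs ((-1) ^ k) = 1.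
Proof. rewrite <- RPow_abs, Rabs_left by lra. replace (- -1) with 1 by ring. apply pow1. Qed.

(** An interior node ends two intervals of opposite sign, hence the factor 2. The terms at the first
    three nodes complete the alternating sum, which has to start at [p 0] for the orthogonality
    relation, and are compensated outside it. *)
Lemma abs_int_nodes m : (3 + m <= n)%nat ->
  is_RInt (fun x => Rabs (t x)) (p 2%nat) (p (2 + m)%nat)
   (- 2 * alt_sum (fun j => F (p j)) (3 + m) + 2 * F (p 0%nat) - 2 * F (p 1%nat) + F (p 2%nat)
     + (-1) ^ m * F (p (2 + m)%nat)).
Proof.
induction m as [|m IH]; intros Hm.
  replace (p (2 + 0)%nat) with (p 2%nat) by (f_equal; lia).
  match goal with |- is_RInt _ _ _ ?v => replace v with 0 by (simpl; ring) end.
  apply (@is_RInt_point R_NormedModule).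
assert (IH' := IH ltac:(lia)).
assert (K : is_RInt (fun x => Rabs (t x)) (p (2 + m)%nat) (p (2 + S m)%nat)
   ((-1) ^ (2 + m) * (F (p (2 + S m)%nat) - F (p (2 + m)%nat)))).
{ apply abs_int_piece; [apply Rabs_pow_m1|apply Rlt_le, node_lt; lia|].
  intros x Hx. apply discrete_phihat_tail_sign; [lia| |].
    replace (S (2 + m)) with (2 + S m)%nat by lia. exact Hx.
  assert (A := node_lt_half n (2 + S m) ltac:(lia)). fold (p (2 + S m)%nat) in A. lra. }
assert (J := is_RInt_Chasles _ _ _ _ _ _ IH' K).
match type of J with is_RInt _ _ _ ?v => match goal with |- is_RInt _ _ _ ?w =>
  replace w with v; [exact J|] end end.
unfold plus; simpl. ring.
Qed.

(** By orthogonality the alternating sum over all [n] nodes is a multiple of [F (1 / 2)] and cancels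
    the boundary term of the last interval. Only the first three nodes remain. *)
Lemma abs_int_tail : is_RInt (fun x => Rabs (t x)) (p 2%nat) (1 / 2)
   (2 * F (p 0%nat) - 2 * F (p 1%nat) + F (p 2%nat)).
Proof.
destruct (Nat.le_exists_sub 3 n Hn) as [m [Em _]].
assert (J := abs_int_nodes m ltac:(lia)).
assert (Hr : 0 < INR n) by now apply lt_0_INR.
assert (K : is_RInt (fun x => Rabs (t x)) (p (2 + m)%nat) (1 / 2)
   ((-1) ^ (2 + m) * (F (1 / 2) - F (p (2 + m)%nat)))).
{ assert (A := node_lt_half n (2 + m) ltac:(lia)). fold (p (2 + m)%nat) in A.
  apply abs_int_piece; [apply Rabs_pow_m1|lra|].
  intros x Hx. apply discrete_phihat_tail_sign; [lia| |lra].
  (* Here [2 + m = n - 1] is the last node before [1 / 2], and the next one is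
     [1 / 2 + 1 / (4 n)]. *)
  split; [lra|]. replace (p (S (2 + m))) with (1 / 2 + / (4 * INR n)).
    apply Rlt_trans with (1 / 2); [lra|]. assert (0 < / (4 * INR n)); [|lra].
    apply Rinv_0_lt_compat. lra.
  unfold p, node. replace (S (2 + m)) with n by lia. field. lra. }
assert (L := is_RInt_Chasles _ _ _ _ _ _ J K).
match type of L with is_RInt _ _ _ ?v => match goal with |- is_RInt _ _ _ ?w =>
  replace w with v; [exact L|] end end.
assert (O := cos_sum_orthogonality b n n (Nat.le_refl n)).
replace (3 + m)%nat with n by lia. fold F p in O.
change (fun j : nat => cos_sum_primitive b n (node n j)) with (fun j => F (p j)) in O.
assert (E : (-1) ^ n = - (-1) ^ m) by (rewrite Em, pow_add; simpl; ring).
rewrite E in O.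
replace ((-1) ^ (2 + m)) with ((-1) ^ m) by (simpl; ring).
set (A := alt_sum (fun j => F (p j)) n) in *.
replace (-2 * A) with (- (2 * A)) by ring. rewrite O. unfold plus; simpl; ring.
Qed.

(** Evenness doubles the sum of head and tail. The result has the shape of the denominator of [rho]:
    integrals over [[0, p 0]] and [[p 1, p 2]], minus the one over [[zeta1, zeta2]]. *)
Lemma normL_discrete_phihat :
  normL t = 4 * (F (p 0%nat) + F (p 2%nat) - F (p 1%nat) - F zeta2 + F zeta1).
Proof.
assert (J := is_RInt_Chasles _ _ _ _ _ _ abs_int_head abs_int_tail).
assert (K : is_RInt (fun x => Rabs (t x)) (- (1 / 2)) 0
  (plus (2 * F zeta1 - 2 * F zeta2 + F (p 2%nat)) (2 * F (p 0%nat) - 2 * F (p 1%nat) + F (p 2%nat)))).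
{ set (v := plus _ _) in *. apply is_RInt_swap in J.
  assert (J' : is_RInt (fun x => Rabs (t x)) (- - (1 / 2)) (- 0) (opp v)).
    now rewrite Ropp_involutive, Ropp_0.
  apply is_RInt_comp_opp, is_RInt_opp in J'. rewrite opp_opp in J'.
  revert J'. apply is_RInt_ext. intros x _. unfold t. rewrite cos_sum_even. apply opp_opp. }
unfold normL. apply is_RInt_unique.
assert (L := is_RInt_Chasles _ _ _ _ _ _ K J).
match type of L with is_RInt _ _ _ ?v => match goal with |- is_RInt _ _ _ ?w =>
  replace w with v; [exact L|] end end.
unfold plus; simpl; ring.
Qed.

End DiscreteNorm.

(** * The kernel of the extremal functions *)

Definition sin_quot (u : R) : R := if Req_EM_T u 0 then 2 * PI else sin (2 * PI * u) / u.

Lemma sin_quot_neq0 u : u <> 0 -> sin_quot u = sin (2 * PI * u) / u.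
Proof. unfold sin_quot. now destruct (Req_EM_T u 0). Qed.

Lemma sin_quot_0 : sin_quot 0 = 2 * PI.
Proof. unfold sin_quot. now destruct (Req_EM_T 0 0). Qed.

Lemma continuous_sin_quot u : continuous sin_quot u.
Proof.
assert (HP := PI_RGT_0). destruct (Req_EM_T u 0) as [->|Hu].
(* At 0, [sin_quot] is the difference quotient of [sin (2 PI u)], so continuity there is
   differentiability of the sine. *)
- assert (D : is_derive (fun u => sin (2 * PI * u)) 0 (2 * PI)).
    auto_derive; trivial. rewrite Rmult_0_r, cos_0. ring.
  apply is_derive_Reals in D. apply continuity_pt_filterlim.
  intros eps Heps. destruct (D eps Heps) as [d Hd].
  exists d. split; [apply d|]. intros x [[_ Hx] Hx']. simpl in *. unfold Rdist in *.
  rewrite Rminus_0_r in Hx'. rewrite sin_quot_0, sin_quot_neq0 by lra.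
  specialize (Hd x ltac:(lra) Hx'). rewrite Rplus_0_l, Rmult_0_r, sin_0, Rminus_0_r in Hd.
  exact Hd.
- apply (continuous_ext_loc _ (fun u => sin (2 * PI * u) / u)).
    assert (Hp : 0 < Rabs u) by now apply Rabs_pos_lt.
    exists (mkposreal _ Hp). intros v Hv. rewrite sin_quot_neq0; trivial.
    intros ->. unfold ball in Hv; simpl in Hv. unfold AbsRing_ball, abs, minus, plus, opp in Hv; simpl in Hv.
    rewrite Rplus_0_l, Rabs_Ropp in Hv. lra.
  apply (ex_derive_continuous (fun u => sin (2 * PI * u) / u)). auto_derive; trivial.
Qed.

Lemma sin_quot_ge0 u : Rabs u <= 1 / 2 -> 0 <= sin_quot u.
Proof.
intros Hu. assert (HP := PI_RGT_0). destruct (Req_EM_T u 0) as [->|Hu0]; [rewrite sin_quot_0; lra|].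
rewrite sin_quot_neq0 by trivial. apply Rabs_le_between in Hu.
destruct (Rlt_or_le 0 u).
  apply Rmult_le_pos; [apply sin_ge_0; nra|]. now apply Rlt_le, Rinv_0_lt_compat.
replace (sin (2 * PI * u) / u) with (sin (2 * PI * (- u)) / (- u)).
  apply Rmult_le_pos; [apply sin_ge_0; nra|]. apply Rlt_le, Rinv_0_lt_compat. lra.
replace (2 * PI * - u) with (- (2 * PI * u)) by ring. rewrite sin_neg. field; trivial.
Qed.

(** Up to sign the cosine is [sin (2 PI (q_k - z))], so [sin_quot] absorbs the vanishing factor
    [q_k - z]. The differences of squares are oriented so that the remaining denominator is positive
    within distance [1 / 2] of [q_k]. *)
Definition kernel1 (z : R) : R :=
  sin_quot (q1 - z) / ((q1 + z) * (q2 ^ 2 - z ^ 2) * (q3 ^ 2 - z ^ 2)).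
Definition kernel2 (z : R) : R :=
  sin_quot (q2 - z) / ((q2 + z) * (z ^ 2 - q1 ^ 2) * (q3 ^ 2 - z ^ 2)).
Definition kernel3 (z : R) : R :=
  sin_quot (q3 - z) / ((q3 + z) * (z ^ 2 - q1 ^ 2) * (z ^ 2 - q2 ^ 2)).

(* [c1 z / omega_den z] without its singularities, for [-1/4 < z < 7/4]. *)
Definition kernel (z : R) : R :=
  if Rlt_dec z (1 / 2) then kernel1 z else if Rlt_dec z 1 then kernel2 z else kernel3 z.

Lemma sin_2PI_q1 z : sin (2 * PI * (q1 - z)) = c1 z.
Proof. unfold c1, q1. rewrite <- sin_shift. f_equal. field. Qed.

Lemma sin_2PI_q2 z : sin (2 * PI * (q2 - z)) = - c1 z.
Proof.
rewrite <- sin_2PI_q1. rewrite <- neg_sin. unfold q1, q2. f_equal. field.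
Qed.

Lemma sin_2PI_q3 z : sin (2 * PI * (q3 - z)) = c1 z.
Proof.
rewrite <- (Ropp_involutive (c1 z)). rewrite <- sin_2PI_q2. rewrite <- neg_sin.
unfold q2, q3. f_equal. field.
Qed.

Lemma kernel1_regular z : -1 / 4 < z < 3 / 4 -> z <> q1 -> kernel1 z = c1 z / omega_den z.
Proof.
intros Hz H1. unfold kernel1. rewrite sin_quot_neq0 by lra. rewrite sin_2PI_q1.
unfold omega_den. unfold q1, q2, q3 in *. field. repeat split; nra.
Qed.

Lemma kernel2_regular z : 1 / 4 < z < 5 / 4 -> z <> q2 -> kernel2 z = c1 z / omega_den z.
Proof.
intros Hz H1. unfold kernel2. rewrite sin_quot_neq0 by lra. rewrite sin_2PI_q2.
unfold omega_den. unfold q1, q2, q3 in *. field. repeat split; nra.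
Qed.

Lemma kernel3_regular z : 3 / 4 < z < 7 / 4 -> z <> q3 -> kernel3 z = c1 z / omega_den z.
Proof.
intros Hz H1. unfold kernel3. rewrite sin_quot_neq0 by lra. rewrite sin_2PI_q3.
unfold omega_den. unfold q1, q2, q3 in *. field. repeat split; nra.
Qed.

Lemma kernel1_ge0 z : -1 / 4 < z < 3 / 4 -> 0 <= kernel1 z.
Proof.
intros Hz. unfold kernel1. apply Rmult_le_pos.
  apply sin_quot_ge0, Rabs_le; unfold q1; lra.
apply Rlt_le, Rinv_0_lt_compat. unfold q1, q2, q3.
repeat apply Rmult_lt_0_compat; nra.
Qed.

Lemma kernel2_ge0 z : 1 / 4 < z < 5 / 4 -> 0 <= kernel2 z.
Proof.
intros Hz. unfold kernel2. apply Rmult_le_pos.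
  apply sin_quot_ge0, Rabs_le; unfold q2; lra.
apply Rlt_le, Rinv_0_lt_compat. unfold q1, q2, q3.
repeat apply Rmult_lt_0_compat; nra.
Qed.

Lemma kernel3_ge0 z : 3 / 4 < z < 7 / 4 -> 0 <= kernel3 z.
Proof.
intros Hz. unfold kernel3. apply Rmult_le_pos.
  apply sin_quot_ge0, Rabs_le; unfold q3; lra.
apply Rlt_le, Rinv_0_lt_compat. unfold q1, q2, q3.
repeat apply Rmult_lt_0_compat; nra.
Qed.

(** The overlaps of the three windows contain no [q_k], so there the local forms equal the same
    quotient. Hence each of them represents [kernel] on a whole neighbourhood of its [q_k]. *)
Lemma kernel_eq1 z : -1 / 4 < z < 3 / 4 -> kernel z = kernel1 z.
Proof.
intros Hz. unfold kernel. destruct (Rlt_dec z (1 / 2)); trivial.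
destruct (Rlt_dec z 1); [|lra].
rewrite kernel2_regular, kernel1_regular; trivial; unfold q1, q2; lra.
Qed.

Lemma kernel_eq2 z : 1 / 4 < z < 5 / 4 -> kernel z = kernel2 z.
Proof.
intros Hz. unfold kernel. destruct (Rlt_dec z (1 / 2)).
  rewrite kernel2_regular, kernel1_regular; trivial; unfold q1, q2; lra.
destruct (Rlt_dec z 1); trivial.
rewrite kernel2_regular, kernel3_regular; trivial; unfold q2, q3; lra.
Qed.

Lemma kernel_eq3 z : 3 / 4 < z < 7 / 4 -> kernel z = kernel3 z.
Proof.
intros Hz. unfold kernel. destruct (Rlt_dec z (1 / 2)); [lra|].
destruct (Rlt_dec z 1); trivial.
rewrite kernel2_regular, kernel3_regular; trivial; unfold q2, q3; lra.
Qed.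

Lemma kernel_window z : -1 / 4 < z < 7 / 4 ->
  -1 / 4 < z < 3 / 4 \/ 1 / 4 < z < 5 / 4 \/ 3 / 4 < z < 7 / 4.
Proof.
intros Hz. destruct (Rlt_dec z (1 / 2)); [left; lra|].
destruct (Rlt_dec z 1); [right; left; lra|right; right; lra].
Qed.

Lemma kernel_ge0 z : -1 / 4 < z < 7 / 4 -> 0 <= kernel z.
Proof.
intros Hz. destruct (kernel_window z Hz) as [H|[H|H]].
  rewrite kernel_eq1 by trivial. now apply kernel1_ge0.
  rewrite kernel_eq2 by trivial. now apply kernel2_ge0.
rewrite kernel_eq3 by trivial. now apply kernel3_ge0.
Qed.

Lemma omega_den_neq0 z : -1 / 4 < z < 7 / 4 -> z <> q1 -> z <> q2 -> z <> q3 -> omega_den z <> 0.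
Proof.
intros Hz A1 A2 A3. unfold omega_den. unfold q1, q2, q3 in *.
repeat apply Rmult_integral_contrapositive_currified.
  replace ((1 / 4) ^ 2 - z ^ 2) with ((1 / 4 - z) * (1 / 4 + z)) by ring.
  apply Rmult_integral_contrapositive_currified; lra.
  replace ((3 / 4) ^ 2 - z ^ 2) with ((3 / 4 - z) * (3 / 4 + z)) by ring.
  apply Rmult_integral_contrapositive_currified; lra.
replace ((5 / 4) ^ 2 - z ^ 2) with ((5 / 4 - z) * (5 / 4 + z)) by ring.
apply Rmult_integral_contrapositive_currified; lra.
Qed.

Lemma kernel_regular z : -1 / 4 < z < 7 / 4 -> omega_den z <> 0 -> kernel z = c1 z / omega_den z.
Proof.
intros Hz Hd. destruct (kernel_window z Hz) as [H|[H|H]].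
- rewrite kernel_eq1, kernel1_regular; trivial. intros E. apply Hd. rewrite E. unfold omega_den; ring.
- rewrite kernel_eq2, kernel2_regular; trivial. intros E. apply Hd. rewrite E. unfold omega_den; ring.
- rewrite kernel_eq3, kernel3_regular; trivial. intros E. apply Hd. rewrite E. unfold omega_den; ring.
Qed.

Lemma locally_interval_in (a b z : R) (P : R -> Prop) : a < z < b ->
  (forall y, a < y < b -> P y) -> locally z P.
Proof.
intros Hz HP. assert (Hd : 0 < Rmin (z - a) (b - z)) by (apply Rmin_pos; lra).
exists (mkposreal _ Hd). intros y Hy. apply HP.
unfold ball in Hy; simpl in Hy. unfold AbsRing_ball, abs, minus, plus, opp in Hy; simpl in Hy.
assert (A := Rmin_l (z - a) (b - z)). assert (B := Rmin_r (z - a) (b - z)).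
apply Rabs_lt_between in Hy. lra.
Qed.

Lemma continuous_sin_quot_over (q : R) (d : R -> R) (z : R) : d z <> 0 -> continuous d z ->
  continuous (fun z => sin_quot (q - z) / d z) z.
Proof.
intros Hd Cd. apply (continuous_mult (fun z => sin_quot (q - z)) (fun z => / d z)).
  apply (continuous_comp (fun z => q - z) sin_quot); [|apply continuous_sin_quot].
  apply (continuous_minus (fun _ => q) (fun z => z)); [apply continuous_const|apply continuous_id].
apply (continuous_comp d Rinv); trivial. now apply continuous_Rinv.
Qed.

Lemma continuous_kernel z : -1 / 4 < z < 7 / 4 -> continuous kernel z.
Proof.
intros Hz. destruct (kernel_window z Hz) as [H|[H|H]].
- apply (continuous_ext_loc _ kernel1).
    apply (locally_interval_in _ _ _ _ H). intros y Hy. symmetry. now apply kernel_eq1.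
  apply continuous_sin_quot_over; [apply Rgt_not_eq; unfold q1, q2, q3; repeat apply Rmult_lt_0_compat; nra|].
  apply (ex_derive_continuous (fun z => (q1 + z) * (q2 ^ 2 - z ^ 2) * (q3 ^ 2 - z ^ 2))). auto_derive; trivial.
- apply (continuous_ext_loc _ kernel2).
    apply (locally_interval_in _ _ _ _ H). intros y Hy. symmetry. now apply kernel_eq2.
  apply continuous_sin_quot_over; [apply Rgt_not_eq; unfold q1, q2, q3; repeat apply Rmult_lt_0_compat; nra|].
  apply (ex_derive_continuous (fun z => (q2 + z) * (z ^ 2 - q1 ^ 2) * (q3 ^ 2 - z ^ 2))). auto_derive; trivial.
- apply (continuous_ext_loc _ kernel3).
    apply (locally_interval_in _ _ _ _ H). intros y Hy. symmetry. now apply kernel_eq3.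
  apply continuous_sin_quot_over; [apply Rgt_not_eq; unfold q1, q2, q3; repeat apply Rmult_lt_0_compat; nra|].
  apply (ex_derive_continuous (fun z => (q3 + z) * (z ^ 2 - q1 ^ 2) * (z ^ 2 - q2 ^ 2))). auto_derive; trivial.
Qed.

Definition zero_poly (z1 z2 z : R) : R := (z1 ^ 2 - z ^ 2) * (z2 ^ 2 - z ^ 2).

Lemma continuous_zero_poly z1 z2 z : continuous (zero_poly z1 z2) z.
Proof. apply (ex_derive_continuous (fun z => (z1 ^ 2 - z ^ 2) * (z2 ^ 2 - z ^ 2))). auto_derive; trivial. Qed.

Lemma omega_den_locally_neq0 z : -1 / 4 < z < 7 / 4 -> locally' z (fun y => -1 / 4 < y < 7 / 4 /\ omega_den y <> 0).
Proof.
intros Hz. unfold locally', within.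
assert (K : forall a, locally z (fun y => y <> z -> y <> a)).
{ intros a. destruct (Req_dec z a) as [<-|Hne].
    apply filter_forall; trivial.
  assert (Hd : 0 < Rabs (a - z)) by (apply Rabs_pos_lt; lra).
  exists (mkposreal _ Hd). intros y Hy _ ->.
  unfold ball in Hy; simpl in Hy. unfold AbsRing_ball, abs, minus, plus, opp in Hy; simpl in Hy.
  unfold Rminus in Hy. lra. }
assert (L := locally_interval_in _ _ z (fun y => -1 / 4 < y < 7 / 4) Hz (fun y Hy => Hy)).
generalize (filter_and _ _ L (filter_and _ _ (K q1) (filter_and _ _ (K q2) (K q3)))).
apply filter_imp. intros y [A [B1 [B2 B3]]] Hy. split; trivial.
apply omega_den_neq0; auto.
Qed.

(** The right-hand side is continuous and agrees with [omega * c1] on a punctured neighbourhood,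
    hence equals the limit that defines [phihat] at a zero of [omega_den]. *)
Lemma phihat_kernel z1 z2 z : -1 / 4 < z < 7 / 4 -> phihat z1 z2 z = zero_poly z1 z2 z * kernel z.
Proof.
intros Hz. unfold phihat. destruct (Req_EM_T (omega_den z) 0) as [E|E].
- assert (C : is_lim (fun y => zero_poly z1 z2 y * kernel y) z (zero_poly z1 z2 z * kernel z)).
    apply (is_lim_continuity (fun y => zero_poly z1 z2 y * kernel y)), continuity_pt_filterlim.
    apply (continuous_mult (zero_poly z1 z2) kernel); [apply continuous_zero_poly|now apply continuous_kernel].
  rewrite (is_lim_unique _ _ (Finite (zero_poly z1 z2 z * kernel z))); trivial.
  revert C. apply is_lim_ext_loc.
  simpl. generalize (omega_den_locally_neq0 z Hz). apply filter_imp. intros y [Hy Hd].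
  rewrite kernel_regular by trivial. unfold omega, zero_poly. field; trivial.
- rewrite kernel_regular by trivial. unfold omega, zero_poly. field; trivial.
Qed.

(** * Global optimality *)

Definition moment (m : nat) (a b : R) : R := RInt (fun z => kernel z * z ^ (2 * m)) a b.

Lemma continuous_kernel_pow m z : -1 / 4 < z < 7 / 4 -> continuous (fun z => kernel z * z ^ m) z.
Proof.
intros Hz. apply (continuous_mult kernel (fun z => z ^ m)); [now apply continuous_kernel|].
apply (ex_derive_continuous (fun z => z ^ m)). auto_derive; trivial.
Qed.

Lemma ex_RInt_window (f : R -> R) a b :
  (forall z, -1 / 4 < z < 7 / 4 -> continuous f z) ->
  -1 / 4 < a < 7 / 4 -> -1 / 4 < b < 7 / 4 -> ex_RInt f a b.
Proof.
intros Hf Ha Hb. apply (@ex_RInt_continuous R_CompleteNormedModule). intros z Hz. apply Hf.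
unfold Rmin, Rmax in Hz. destruct (Rle_dec a b); lra.
Qed.

Lemma is_RInt_moment m a b : -1 / 4 < a < 7 / 4 -> -1 / 4 < b < 7 / 4 ->
  is_RInt (fun z => kernel z * z ^ (2 * m)) a b (moment m a b).
Proof.
intros. apply (@RInt_correct R_CompleteNormedModule), ex_RInt_window; trivial.
intros; now apply continuous_kernel_pow.
Qed.

Lemma moment_Chasles m a b c : -1 / 4 < a < 7 / 4 -> -1 / 4 < b < 7 / 4 -> -1 / 4 < c < 7 / 4 ->
  moment m a b + moment m b c = moment m a c.
Proof.
intros. symmetry. apply (@is_RInt_unique R_CompleteNormedModule).
apply (@is_RInt_Chasles R_NormedModule _ a b c); now apply is_RInt_moment.
Qed.

Lemma is_RInt_phihat z1 z2 a b : -1 / 4 < a < 7 / 4 -> -1 / 4 < b < 7 / 4 ->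
  is_RInt (phihat z1 z2) a b
   (z1 ^ 2 * z2 ^ 2 * moment 0 a b - (z1 ^ 2 + z2 ^ 2) * moment 1 a b + moment 2 a b).
Proof.
intros Ha Hb.
apply (is_RInt_ext (fun z => z1 ^ 2 * z2 ^ 2 * (kernel z * z ^ (2 * 0)) -
   (z1 ^ 2 + z2 ^ 2) * (kernel z * z ^ (2 * 1)) + kernel z * z ^ (2 * 2))).
  intros z Hz. rewrite phihat_kernel. unfold zero_poly. simpl. ring.
  unfold Rmin, Rmax in Hz. destruct (Rle_dec a b); lra.
assert (M := fun m => is_RInt_moment m a b Ha Hb).
exact (is_RInt_plus _ _ _ _ _ _ (is_RInt_minus _ _ _ _ _ _ (is_RInt_scal _ _ _ (z1 ^ 2 * z2 ^ 2) _ (M 0%nat))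
  (is_RInt_scal _ _ _ (z1 ^ 2 + z2 ^ 2) _ (M 1%nat))) (M 2%nat)).
Qed.

Lemma continuous_phihat z1 z2 z : -1 / 4 < z < 7 / 4 -> continuous (phihat z1 z2) z.
Proof.
intros Hz. apply (continuous_ext_loc _ (fun z => zero_poly z1 z2 z * kernel z)).
  apply (locally_interval_in _ _ _ _ Hz). intros y Hy. symmetry. now apply phihat_kernel.
apply (continuous_mult (zero_poly z1 z2) kernel); [apply continuous_zero_poly|now apply continuous_kernel].
Qed.

Lemma phihat_ge0_l z1 z2 z : 0 <= z <= z1 -> z1 <= z2 -> z1 < 7 / 4 -> 0 <= phihat z1 z2 z.
Proof.
intros. rewrite phihat_kernel by lra. apply Rmult_le_pos; [|apply kernel_ge0; lra].
unfold zero_poly. apply Rmult_le_pos; nra.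
Qed.

Lemma phihat_ge0_r z1 z2 z : 0 <= z1 <= z2 -> z2 <= z < 7 / 4 -> 0 <= phihat z1 z2 z.
Proof.
intros. rewrite phihat_kernel by lra. apply Rmult_le_pos; [|apply kernel_ge0; lra].
unfold zero_poly. replace ((z1 ^ 2 - z ^ 2) * (z2 ^ 2 - z ^ 2)) with ((z ^ 2 - z1 ^ 2) * (z ^ 2 - z2 ^ 2)) by ring.
apply Rmult_le_pos; nra.
Qed.

Lemma phihat_le0 z1 z2 z : 0 <= z1 <= z -> z <= z2 < 7 / 4 -> phihat z1 z2 z <= 0.
Proof.
intros. rewrite phihat_kernel by lra. assert (K := kernel_ge0 z ltac:(lra)).
unfold zero_poly. assert (0 <= z ^ 2 - z1 ^ 2) by nra. assert (0 <= z2 ^ 2 - z ^ 2) by nra.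
assert (0 <= (z ^ 2 - z1 ^ 2) * (z2 ^ 2 - z ^ 2) * kernel z) by (repeat apply Rmult_le_pos; lra).
lra.
Qed.

(** To the left of [z1] the integrand is nonnegative, and from [z1] to 1 it is nonpositive. Moving
    the lower limit away from [z1] in either direction can only increase the integral. *)
Lemma RInt_phihat_minimal_l z1 z2 x : 1 / 2 < z1 < 1 -> 1 < z2 < 3 / 2 -> 1 / 2 < x < 1 ->
  RInt (phihat z1 z2) z1 1 <= RInt (phihat z1 z2) x 1.
Proof.
intros H1 H2 Hx.
assert (EX : forall a b, -1 / 4 < a < 7 / 4 -> -1 / 4 < b < 7 / 4 -> ex_RInt (phihat z1 z2) a b).
  intros; apply ex_RInt_window; trivial. intros; now apply continuous_phihat.
destruct (Rle_dec x z1).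
- rewrite <- (RInt_Chasles (phihat z1 z2) x z1 1) by (apply EX; lra).
  assert (0 <= RInt (phihat z1 z2) x z1).
    apply RInt_ge_0; [lra|apply EX; lra|]. intros; apply phihat_ge0_l; lra.
  unfold plus; simpl; lra.
- rewrite <- (RInt_Chasles (phihat z1 z2) z1 x 1) by (apply EX; lra).
  assert (0 <= RInt (fun z => - phihat z1 z2 z) z1 x).
    apply RInt_ge_0; [lra|apply (@ex_RInt_opp R_NormedModule), EX; lra|].
    intros z Hz; assert (A := phihat_le0 z1 z2 z); lra.
  rewrite (@RInt_opp R_CompleteNormedModule) in H by (apply EX; lra).
  unfold plus, opp in *; simpl in *; lra.
Qed.

Lemma RInt_phihat_minimal_r z1 z2 y : 1 / 2 < z1 < 1 -> 1 < z2 < 3 / 2 -> 1 < y < 3 / 2 ->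
  RInt (phihat z1 z2) 1 z2 <= RInt (phihat z1 z2) 1 y.
Proof.
intros H1 H2 Hx.
assert (EX : forall a b, -1 / 4 < a < 7 / 4 -> -1 / 4 < b < 7 / 4 -> ex_RInt (phihat z1 z2) a b).
  intros; apply ex_RInt_window; trivial. intros; now apply continuous_phihat.
destruct (Rle_dec z2 y).
- rewrite <- (RInt_Chasles (phihat z1 z2) 1 z2 y) by (apply EX; lra).
  assert (0 <= RInt (phihat z1 z2) z2 y).
    apply RInt_ge_0; [lra|apply EX; lra|]. intros; apply phihat_ge0_r; lra.
  unfold plus; simpl; lra.
- rewrite <- (RInt_Chasles (phihat z1 z2) 1 y z2) by (apply EX; lra).
  assert (0 <= RInt (fun z => - phihat z1 z2 z) y z2).
    apply RInt_ge_0; [lra|apply (@ex_RInt_opp R_NormedModule), EX; lra|].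
    intros z Hz; assert (A := phihat_le0 z1 z2 z); lra.
  rewrite (@RInt_opp R_CompleteNormedModule) in H by (apply EX; lra).
  unfold plus, opp in *; simpl in *; lra.
Qed.

(* The three integrals in the denominator of [rho] add up to
   [int_0^q1 - int_x^q2 + int_y^q3], taken here against [kernel z * z ^ (2 m)]. *)
Definition defect (m : nat) (x y : R) : R := moment m 0 q1 - moment m x q2 + moment m y q3.

(** With the limits [x], [y] freed from the zeros [z1], [z2], the value is linear in the
    coefficients of the even polynomial; the case [x = z1], [y = z2] is the one in [rho]. *)
Definition rho_integrals (z1 z2 x y : R) : R :=
  RInt (phihat z1 z2) 0 q1 + RInt (phihat z1 z2) q2 q3 - RInt (phihat z1 z2) x y.

Lemma rho_integrals_defect z1 z2 x y : -1 / 4 < x < 7 / 4 -> -1 / 4 < y < 7 / 4 ->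
  rho_integrals z1 z2 x y =
  z1 ^ 2 * z2 ^ 2 * defect 0 x y - (z1 ^ 2 + z2 ^ 2) * defect 1 x y + defect 2 x y.
Proof.
intros Hx Hy. unfold rho_integrals.
assert (Q : -1 / 4 < 0 < 7 / 4 /\ -1 / 4 < q1 < 7 / 4 /\ -1 / 4 < q2 < 7 / 4 /\ -1 / 4 < q3 < 7 / 4).
  unfold q1, q2, q3; lra.
destruct Q as [Q0 [Q1 [Q2 Q3]]].
rewrite !(is_RInt_unique _ _ _ _ (is_RInt_phihat z1 z2 _ _ Q0 Q1)).
rewrite !(is_RInt_unique _ _ _ _ (is_RInt_phihat z1 z2 _ _ Q2 Q3)).
rewrite !(is_RInt_unique _ _ _ _ (is_RInt_phihat z1 z2 _ _ Hx Hy)).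
assert (C : forall m, moment m q2 q3 - moment m x y = moment m y q3 - moment m x q2).
{ intros m. assert (A := moment_Chasles m x q2 q3 Hx Q2 Q3).
  assert (B := moment_Chasles m x y q3 Hx Hy Q3). lra. }
unfold defect. assert (C0 := C 0%nat). assert (C1 := C 1%nat). assert (C2 := C 2%nat).
replace (moment 0 x y) with (moment 0 q2 q3 - (moment 0 y q3 - moment 0 x q2)) by lra.
replace (moment 1 x y) with (moment 1 q2 q3 - (moment 1 y q3 - moment 1 x q2)) by lra.
replace (moment 2 x y) with (moment 2 q2 q3 - (moment 2 y q3 - moment 2 x q2)) by lra.
ring.
Qed.

Lemma kernel_0 : kernel 0 = / (q1 * q2 * q3) ^ 2.
Proof.
rewrite kernel_regular; [| lra | apply omega_den_neq0; unfold q1, q2, q3; lra].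
unfold c1, omega_den. rewrite !Rmult_0_r, cos_0. unfold q1, q2, q3. field.
Qed.

Lemma phihat_0 z1 z2 : phihat z1 z2 0 = z1 ^ 2 * z2 ^ 2 * kernel 0.
Proof. rewrite phihat_kernel by lra. unfold zero_poly. ring. Qed.

Section Optimality.

Variables x y : R.
Hypothesis Hreg : region x y.
Hypothesis E1 : defect 1 x y = 0.
Hypothesis E2 : defect 2 x y = 0.
Hypothesis E0 : 0 < defect 0 x y.

(** Only the constant coefficient [x^2 y^2] survives in the denominator, and it cancels against the
    same factor of [phihat x y 0]. *)
Lemma rho_critical : rho x y = kernel 0 / (4 * defect 0 x y).
Proof.
destruct Hreg as [Hx Hy]. unfold rho. fold (rho_integrals x y x y).
rewrite rho_integrals_defect, E1, E2, phihat_0 by lra. field. repeat split; lra.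
Qed.

Lemma rho_le_critical z1 z2 : region z1 z2 -> rho z1 z2 <= rho x y.
Proof.
intros [H1 H2]. destruct Hreg as [Hx Hy]. rewrite rho_critical.
assert (EX : forall a b, -1 / 4 < a < 7 / 4 -> -1 / 4 < b < 7 / 4 -> ex_RInt (phihat z1 z2) a b).
  intros; apply ex_RInt_window; trivial. intros; now apply continuous_phihat.
assert (A : z1 ^ 2 * z2 ^ 2 * defect 0 x y <= rho_integrals z1 z2 z1 z2).
{ apply Rle_trans with (rho_integrals z1 z2 x y).
    rewrite rho_integrals_defect, E1, E2 by lra. lra.
  unfold rho_integrals.
  rewrite <- (RInt_Chasles (phihat z1 z2) x 1 y) by (apply EX; lra).
  rewrite <- (RInt_Chasles (phihat z1 z2) z1 1 z2) by (apply EX; lra).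
  assert (L := RInt_phihat_minimal_l z1 z2 x H1 H2 Hx).
  assert (L' := RInt_phihat_minimal_r z1 z2 y H1 H2 Hy).
  unfold plus; simpl; lra. }
unfold rho. fold (rho_integrals z1 z2 z1 z2). rewrite phihat_0.
assert (P : 0 < z1 ^ 2 * z2 ^ 2) by (apply Rmult_lt_0_compat; apply pow_lt; lra).
assert (P' : 0 < z1 ^ 2 * z2 ^ 2 * defect 0 x y) by now apply Rmult_lt_0_compat.
assert (K : 0 < kernel 0).
  rewrite kernel_0. apply Rinv_0_lt_compat, pow_lt. unfold q1, q2, q3; lra.
replace (kernel 0 / (4 * defect 0 x y)) with
  (z1 ^ 2 * z2 ^ 2 * kernel 0 * / (4 * (z1 ^ 2 * z2 ^ 2 * defect 0 x y))).
  apply Rmult_le_compat_l; [apply Rmult_le_pos; lra|]. apply Rinv_le_contravar; lra.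
field. repeat split; lra.
Qed.

End Optimality.

(** * Numerical enclosures *)

(** Consecutive partial sums of the alternating series for [PI / 4 = 2 atan (1/3) + atan (1/7)]. *)
Lemma PI_near : Rabs (PI - 3141592653 / 1000000000) <= 1 / 1000000000.
Proof.
destruct (PI_2_3_7_ineq 5) as [L U]. apply Rabs_le.
unfold tg_alt, PI_2_3_7_tg, Ratan_seq in L, U. simpl in L, U. lra.
Qed.

(** * Computation with rational polynomials *)

Local Arguments Qred : simpl never.
Local Arguments Qplus : simpl never.
Local Arguments Qmult : simpl never.

Fixpoint qeval (l : list Q) (u : R) : R :=
  match l with [] => 0 | c :: l' => Q2R c + u * qeval l' u end.

(** The counterpart of [qeval] that [vm_compute] runs; [Qred] keeps the fractions small. *)
Fixpoint qevalQ (l : list Q) (u : Q) : Q :=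
  match l with [] => 0%Q | c :: l' => Qred (c + u * qevalQ l' u) end.

Fixpoint qadd (l l' : list Q) : list Q :=
  match l, l' with
  | [], _ => l'
  | _, [] => l
  | c :: m, c' :: m' => Qred (c + c') :: qadd m m'
  end.

Definition qscale (r : Q) (l : list Q) : list Q := map (fun c => Qred (r * c)) l.

Fixpoint qmul (l l' : list Q) : list Q :=
  match l with [] => [] | c :: m => qadd (qscale c l') (0%Q :: qmul m l') end.

Fixpoint qpow (l : list Q) (n : nat) : list Q :=
  match n with O => [1%Q] | S m => qmul l (qpow l m) end.

Fixpoint qprim_from (k : positive) (l : list Q) : list Q :=
  match l with [] => [] | c :: m => (c * (1 # k))%Q :: qprim_from (Pos.succ k) m end.

Definition qprim (l : list Q) : list Q := 0%Q :: qprim_from 1 l.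

Definition qbound (l : list Q) (u : Q) : Q := qevalQ (map Qabs l) u.

Lemma Q2R_Qred c : Q2R (Qred c) = Q2R c.
Proof. apply Qeq_eqR, Qred_correct. Qed.

Lemma qeval_Q2R l u : qeval l (Q2R u) = Q2R (qevalQ l u).
Proof.
induction l as [|c l IH]; simpl; [unfold Q2R; simpl; ring|].
now rewrite Q2R_Qred, Q2R_plus, Q2R_mult, IH.
Qed.

Lemma qeval_add l l' u : qeval (qadd l l') u = qeval l u + qeval l' u.
Proof.
revert l'. induction l as [|c l IH]; intros [|c' l']; simpl; try ring.
rewrite IH, Q2R_Qred, Q2R_plus. ring.
Qed.

Lemma qeval_scale r l u : qeval (qscale r l) u = Q2R r * qeval l u.
Proof.
induction l as [|c l IH]; simpl; [ring|]. rewrite IH, Q2R_Qred, Q2R_mult. ring.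
Qed.

Lemma qeval_mul l l' u : qeval (qmul l l') u = qeval l u * qeval l' u.
Proof.
induction l as [|c l IH]; simpl; [ring|]. rewrite qeval_add, qeval_scale. simpl. rewrite IH.
replace (Q2R 0) with 0 by (unfold Q2R; simpl; ring). ring.
Qed.

Lemma qeval_pow l n u : qeval (qpow l n) u = qeval l u ^ n.
Proof.
induction n as [|n IH]; simpl; [unfold Q2R; simpl; field|]. now rewrite qeval_mul, IH.
Qed.

Lemma Q2R_Qabs c : Q2R (Qabs c) = Rabs (Q2R c).
Proof.
destruct (Qlt_le_dec c 0) as [H|H].
- rewrite (Qeq_eqR _ _ (Qabs_neg c (Qlt_le_weak _ _ H))), Q2R_opp.
  apply Qlt_Rlt in H. replace (Q2R 0) with 0 in H by (unfold Q2R; simpl; ring).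
  now rewrite Rabs_left.
- rewrite (Qeq_eqR _ _ (Qabs_pos c H)). apply Qle_Rle in H.
  replace (Q2R 0) with 0 in H by (unfold Q2R; simpl; ring). now rewrite Rabs_pos_eq.
Qed.

Lemma qeval_bound l u U : 0 <= u <= Q2R U -> Rabs (qeval l u) <= Q2R (qbound l U).
Proof.
intros Hu. unfold qbound. rewrite <- qeval_Q2R.
induction l as [|c l IH]; simpl; [rewrite Rabs_R0; lra|].
apply Rle_trans with (1 := Rabs_triang _ _). rewrite Q2R_Qabs. apply Rplus_le_compat_l.
rewrite Rabs_mult, (Rabs_pos_eq u) by lra. apply Rmult_le_compat; try lra. apply Rabs_pos.
Qed.

(** The powers of [u] record the position of a suffix in the coefficient list, which lets the
    induction peel off one coefficient at a time. *)
Lemma is_derive_qprim_from l k u :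
  is_derive (fun u => u ^ Pos.to_nat k * qeval (qprim_from k l) u) u
    (u ^ (Pos.to_nat k - 1) * qeval l u).
Proof.
revert k. induction l as [|c l IH]; intros k; simpl.
  apply (is_derive_ext (fun _ => 0)); [intros v; symmetry; apply Rmult_0_r|].
  rewrite Rmult_0_r. exact (is_derive_const 0 u).
apply (is_derive_ext (fun u => Q2R (c * (1 # k)) * u ^ Pos.to_nat k
   + u ^ Pos.to_nat (Pos.succ k) * qeval (qprim_from (Pos.succ k) l) u)).
  intros v. rewrite Pos2Nat.inj_succ. cbn [pow]. match goal with |- ?a = ?b => change (@eq R a b) end. ring.
rewrite Rmult_plus_distr_l.
apply (is_derive_plus (fun u => Q2R (c * (1 # k)) * u ^ Pos.to_nat k)
   (fun u => u ^ Pos.to_nat (Pos.succ k) * qeval (qprim_from (Pos.succ k) l) u)).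
- assert (Hk : 0 < INR (Pos.to_nat k)) by (apply lt_0_INR, Pos2Nat.is_pos).
  auto_derive; trivial. rewrite Q2R_mult.
  replace (Q2R (1 # k)) with (/ INR (Pos.to_nat k)).
    replace (pred (Pos.to_nat k)) with (Pos.to_nat k - 1)%nat by lia. field. lra.
  unfold Q2R. simpl. rewrite INR_IZR_INZ, positive_nat_Z. ring.
- replace (u ^ (Pos.to_nat k - 1) * (u * qeval l u)) with
    (u ^ (Pos.to_nat (Pos.succ k) - 1) * qeval l u); [apply IH|].
  replace (Pos.to_nat (Pos.succ k) - 1)%nat with (S (Pos.to_nat k - 1)).
    simpl; ring.
  assert (A := Pos2Nat.is_pos k). rewrite Pos2Nat.inj_succ. lia.
Qed.

Lemma is_derive_qprim l u : is_derive (qeval (qprim l)) u (qeval l u).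
Proof.
apply (is_derive_ext (fun u => u ^ Pos.to_nat 1 * qeval (qprim_from 1 l) u)).
  intros v. simpl. replace (Q2R 0) with 0 by (unfold Q2R; simpl; ring). change (Pos.to_nat 1) with 1%nat. ring.
replace (qeval l u) with (u ^ (Pos.to_nat 1 - 1) * qeval l u) by (simpl; ring).
apply is_derive_qprim_from.
Qed.

Lemma continuous_qeval l u : continuous (qeval l) u.
Proof.
induction l as [|c l IH]; simpl; [apply continuous_const|].
apply (continuous_plus (fun _ => Q2R c) (fun u => u * qeval l u)); [apply continuous_const|].
apply (continuous_mult (fun u => u) (qeval l)); [apply continuous_id|trivial].
Qed.

(** The expansions are in [u = q - z], so a primitive in [z] is [- qeval (qprim l) (q - z)]. It
    vanishes at the upper limit because [qprim] has constant term 0. *)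
Lemma is_RInt_qeval_reflected l a q :
  is_RInt (fun z => qeval l (q - z)) a q (qeval (qprim l) (q - a)).
Proof.
assert (E : qeval (qprim l) (q - a) = - qeval (qprim l) (q - q) - - qeval (qprim l) (q - a)).
  rewrite Rminus_diag. simpl. replace (Q2R 0) with 0 by (unfold Q2R; simpl; ring). ring.
rewrite E. apply (is_RInt_derive (fun z => - qeval (qprim l) (q - z))).
- intros z _. replace (qeval l (q - z)) with (- (-1 * qeval l (q - z))) by ring.
  apply (is_derive_opp (fun z => qeval (qprim l) (q - z))).
  apply (is_derive_comp (qeval (qprim l)) (fun z => q - z)); [apply is_derive_qprim|].
  auto_derive; trivial.
- intros z _. apply (continuous_comp (fun z => q - z) (qeval l)); [|apply continuous_qeval].
  apply (continuous_minus (fun _ => q) (fun z => z)); [apply continuous_const|apply continuous_id].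
Qed.

Lemma Rabs_sin_minus_le a b : Rabs (sin a - sin b) <= Rabs (a - b).
Proof.
destruct (MVT_abs sin cos b a) as [c [E _]].
  intros; apply derivable_pt_lim_sin.
rewrite E. assert (Rabs (cos c) <= 1) by (apply Rabs_le, COS_bound).
assert (A := Rabs_pos (a - b)). nra.
Qed.

Lemma INR_fact_S n : INR (fact (S n)) = INR (S n) * INR (fact n).
Proof. now rewrite fact_simpl, mult_INR. Qed.

(* Taylor coefficients of [sin (p * u) / u], with [p = 2 * 3.141592653] close to [2 * PI]. *)
Definition sin_quot_taylor : list Q :=
  let p := 6283185306 # 1000000000 in
  let s := (p * p)%Q in
  ([p; 0; p * s * (-1 # 6); 0; p * s * s * (1 # 120); 0; p * s * s * s * (-1 # 5040); 0;
   p * s * s * s * s * (1 # 362880); 0; p * s * s * s * s * s * (-1 # 39916800); 0;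
   p * s * s * s * s * s * s * (1 # 6227020800)])%Q.

Lemma qeval_sin_quot_taylor u :
  u * qeval sin_quot_taylor u = sin_approx (2 * (3141592653 / 1000000000) * u) 6.
Proof.
unfold sin_approx, sin_term. cbn [sum_f_R0 Nat.mul Nat.add].
rewrite !INR_fact_S. change (fact 0) with 1%nat.
rewrite !S_INR, INR_0.
unfold sin_quot_taylor. cbn [qeval]. rewrite !Q2R_mult.
unfold Q2R. cbn [Qnum Qden]. field.
Qed.

(** Relative to [u], truncating the series costs at most [1 / 200000000] and replacing [PI] by [p]
    at most [1 / 500000000]. *)
Lemma sin_quot_approx u : 0 < u <= 1 / 4 ->
  Rabs (sin_quot u - qeval sin_quot_taylor u) <= 1 / 100000000.
Proof.
intros Hu. set (p := 3141592653 / 1000000000). assert (HP := PI_near). fold p in HP.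
set (a := 2 * p * u).
assert (Ha : 0 <= a <= 16 / 10) by (unfold a, p; lra).
(* The upper bound of degree 13 and the lower bound of degree 15 differ by the single term
   [a^15 / 15!]. *)
destruct (pre_sin_bound a 2 ltac:(lra) ltac:(lra)) as [_ U].
destruct (pre_sin_bound a 3 ltac:(lra) ltac:(lra)) as [L _].
change (2 * (2 + 1))%nat with 6%nat in U. change (2 * 3 + 1)%nat with 7%nat in L.
assert (T : sin_approx a 7 = sin_approx a 6 - a ^ 15 / 1307674368000).
{ change (sin_approx a 7) with (sin_approx a 6 + sin_term a 7). unfold sin_term.
  change (2 * 7 + 1)%nat with 15%nat. rewrite !INR_fact_S. change (fact 0) with 1%nat.
  rewrite !S_INR, INR_0. field. }
assert (Hu14 : a ^ 14 <= (16 / 10) ^ 14) by (apply pow_incr; lra).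
assert (Ht := qeval_sin_quot_taylor u). fold p a in Ht. rewrite <- Ht in U, T. clear Ht.
set (A := qeval sin_quot_taylor u) in *.
assert (S1 : Rabs (sin a - u * A) <= u * (1 / 200000000)).
{ apply Rabs_le. split; [|nra].
  assert (a ^ 15 <= 2 * p * u * (16 / 10) ^ 14).
    replace (a ^ 15) with (a * a ^ 14) by ring. fold a. apply Rmult_le_compat_l; lra.
  unfold p in *. lra. }
assert (S2 : Rabs (sin (2 * PI * u) - sin a) <= u * (1 / 500000000)).
{ apply Rle_trans with (1 := Rabs_sin_minus_le _ _).
  replace (2 * PI * u - a) with (2 * u * (PI - p)) by (unfold a; ring).
  rewrite Rabs_mult, Rabs_pos_eq by lra. nra. }
rewrite sin_quot_neq0 by lra.
replace (sin (2 * PI * u) / u - A) with ((sin (2 * PI * u) - sin a + (sin a - u * A)) / u) by (field; lra).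
unfold Rdiv at 1. rewrite Rabs_mult, Rabs_inv, (Rabs_pos_eq u) by lra.
apply (Rmult_le_reg_r u); [lra|]. rewrite Rmult_assoc, Rinv_l, Rmult_1_r by lra.
apply Rle_trans with (1 := Rabs_triang _ _). lra.
Qed.

(** The coefficients [l] are validated a posteriori: with [T] the Taylor polynomial, the residual
    [T - d l] is a rational polynomial, bounded on [[0, U]] through the absolute values of its
    coefficients and then divided by [dmin]. *)
Lemma sin_quot_ratio_approx (d l : list Q) (dmin e U : Q) u :
  0 < u <= Q2R U -> (U <= 1 # 4)%Q -> (0 < dmin)%Q -> Q2R dmin <= qeval d u ->
  (((1 # 100000000) + qbound (qadd sin_quot_taylor (qscale (-1) (qmul d l))) U) <= e * dmin)%Q ->
  Rabs (sin_quot u / qeval d u - qeval l u) <= Q2R e.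
Proof.
intros Hu HU Hd Hdu He. apply Qle_Rle in HU, He. apply Qlt_Rlt in Hd.
rewrite Q2R_plus, Q2R_mult in He.
replace (Q2R (1 # 4)) with (1 / 4) in HU by (unfold Q2R; simpl; field).
replace (Q2R 0) with 0 in Hd by (unfold Q2R; simpl; ring).
replace (Q2R (1 # 100000000)) with (1 / 100000000) in He by (unfold Q2R; simpl; field).
assert (A := sin_quot_approx u ltac:(lra)).
assert (B := qeval_bound (qadd sin_quot_taylor (qscale (-1) (qmul d l))) u U ltac:(lra)).
rewrite qeval_add, qeval_scale, qeval_mul in B.
replace (Q2R (-1)) with (-1) in B by (unfold Q2R; simpl; field).
set (D := qeval d u) in *. set (S := sin_quot u) in *. set (T := qeval sin_quot_taylor u) in *.
replace (S / D - qeval l u) with ((S - T + (T + -1 * (D * qeval l u))) / D) by (field; lra).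
unfold Rdiv at 1. rewrite Rabs_mult, Rabs_inv, (Rabs_pos_eq D) by lra.
apply (Rmult_le_reg_r D); [lra|]. rewrite Rmult_assoc, Rinv_l, Rmult_1_r by lra.
apply Rle_trans with (1 := Rabs_triang _ _).
assert (0 <= Q2R e).
{ apply (Rmult_le_reg_r (Q2R dmin)); trivial. rewrite Rmult_0_l.
  assert (P1 := Rabs_pos (S - T)). assert (P2 := Rabs_pos (T + -1 * (D * qeval l u))). lra. }
apply Rle_trans with (Q2R e * Q2R dmin); [lra|]. now apply Rmult_le_compat_l.
Qed.

(* Rounded Taylor coefficients of [kernel (q_k - u)] at [u = 0] *)
Definition kernel_taylor1 : list Q :=
  [16755160819 # 1000000000; 11170107213 # 1000000000; (-19021997070) # 1000000000;
   (-12681331380) # 1000000000; 9795457813 # 1000000000; 6530305209 # 1000000000;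
   (-3072088023) # 1000000000; (-2048058682) # 1000000000; 664305656 # 1000000000;
   442870437 # 1000000000]%Q.
Definition kernel_taylor2 : list Q :=
  [8377580410 # 1000000000; 18151424221 # 1000000000; 5149767182 # 1000000000;
   (-13276780634) # 1000000000; (-8081327101) # 1000000000]%Q.
Definition kernel_taylor3 : list Q :=
  [1675516082 # 1000000000; 7651523441 # 1000000000; 11351132501 # 1000000000;
   3945003746 # 1000000000; (-5348976175) # 1000000000]%Q.

Definition qlin (a s : Q) : list Q := [a; s].

Lemma qeval_qlin a s u : qeval (qlin a s) u = Q2R a + u * Q2R s.
Proof. simpl. ring. Qed.

Definition qprod (l : list (list Q)) : list Q := fold_right qmul [1%Q] l.

(** The denominators of [kernel1], [kernel2], [kernel3] in the variable [u = q_k - z], split into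
    linear factors. *)
Definition kernel_den1 : list Q :=
  qprod [qlin (1 # 2) (-1); qlin (1 # 2) 1; qlin 1 (-1); qlin 1 1; qlin (3 # 2) (-1)].
Definition kernel_den2 : list Q :=
  qprod [qlin (3 # 2) (-1); qlin (1 # 2) (-1); qlin 1 (-1); qlin (1 # 2) 1; qlin 2 (-1)].
Definition kernel_den3 : list Q :=
  qprod [qlin (5 # 2) (-1); qlin 1 (-1); qlin (3 # 2) (-1); qlin (1 # 2) (-1); qlin 2 (-1)].

Ltac qeval_den := unfold qprod; cbn [fold_right]; rewrite !qeval_mul, !qeval_qlin;
  cbn [qeval]; unfold Q2R; cbn [Qnum Qden]; unfold q1, q2, q3.

(** The range of [u] covers the whole interval [[0, q1]], hence the larger number of
    coefficients. *)
Lemma kernel1_approx u : 0 < u <= 1 / 4 ->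
  Rabs (kernel (q1 - u) - qeval kernel_taylor1 u) <= Q2R (5 # 10000000).
Proof.
intros Hu. rewrite kernel_eq1 by (unfold q1; lra). unfold kernel1.
replace (q1 - (q1 - u)) with u by ring.
replace ((q1 + (q1 - u)) * (q2 ^ 2 - (q1 - u) ^ 2) * (q3 ^ 2 - (q1 - u) ^ 2)) with (qeval kernel_den1 u)
  by (unfold kernel_den1; qeval_den; field).
apply (sin_quot_ratio_approx _ _ (2 # 10) _ (1 # 4)).
- unfold Q2R; simpl; lra.
- discriminate.
- reflexivity.
- replace (qeval kernel_den1 u) with ((1 / 4 - u * u) * (1 - u * u) * (3 / 2 - u))
    by (unfold kernel_den1; qeval_den; field).
  unfold Q2R; simpl. assert (0 <= u * u <= 1 / 16) by nra.
  assert (3 / 16 * (15 / 16) <= (1 / 4 - u * u) * (1 - u * u)) by (apply Rmult_le_compat; lra).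
  assert (3 / 16 * (15 / 16) * (5 / 4) <= (1 / 4 - u * u) * (1 - u * u) * (3 / 2 - u)) by (apply Rmult_le_compat; lra).
  lra.
- apply Qle_bool_imp_le. vm_compute. reflexivity.
Qed.

(** The range corresponds to [[72/100, q2]], where the first zero is sought. *)
Lemma kernel2_approx u : 0 < u <= 3 / 100 ->
  Rabs (kernel (q2 - u) - qeval kernel_taylor2 u) <= Q2R (2 # 10000000).
Proof.
intros Hu. rewrite kernel_eq2 by (unfold q2; lra). unfold kernel2.
replace (q2 - (q2 - u)) with u by ring.
replace ((q2 + (q2 - u)) * ((q2 - u) ^ 2 - q1 ^ 2) * (q3 ^ 2 - (q2 - u) ^ 2)) with (qeval kernel_den2 u)
  by (unfold kernel_den2; qeval_den; field).
apply (sin_quot_ratio_approx _ _ (6 # 10) _ (3 # 100)).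
- unfold Q2R; simpl; lra.
- discriminate.
- reflexivity.
- replace (qeval kernel_den2 u) with ((1 / 4 - u * u) * ((3 / 2 - u) * (1 - u) * (2 - u)))
    by (unfold kernel_den2; qeval_den; field).
  unfold Q2R; simpl. assert (0 <= u * u <= 1 / 1000) by nra.
  assert (24 / 100 * (14 / 10 * (96 / 100) * (19 / 10)) <= (1 / 4 - u * u) * ((3 / 2 - u) * (1 - u) * (2 - u)))
    by (repeat apply Rmult_le_compat; lra).
  lra.
- apply Qle_bool_imp_le. vm_compute. reflexivity.
Qed.

(** The range corresponds to [[1233/1000, q3]], where the second zero is sought. *)
Lemma kernel3_approx u : 0 < u <= 17 / 1000 ->
  Rabs (kernel (q3 - u) - qeval kernel_taylor3 u) <= Q2R (3 # 100000000).
Proof.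
intros Hu. rewrite kernel_eq3 by (unfold q3; lra). unfold kernel3.
replace (q3 - (q3 - u)) with u by ring.
replace ((q3 + (q3 - u)) * ((q3 - u) ^ 2 - q1 ^ 2) * ((q3 - u) ^ 2 - q2 ^ 2)) with (qeval kernel_den3 u)
  by (unfold kernel_den3; qeval_den; field).
apply (sin_quot_ratio_approx _ _ (3 # 1) _ (17 # 1000)).
- unfold Q2R; simpl; lra.
- discriminate.
- reflexivity.
- replace (qeval kernel_den3 u) with ((5 / 2 - u) * (1 - u) * (3 / 2 - u) * (1 / 2 - u) * (2 - u))
    by (unfold kernel_den3; qeval_den; field).
  unfold Q2R; simpl.
  assert (248 / 100 * (98 / 100) * (148 / 100) * (48 / 100) * (198 / 100)
    <= (5 / 2 - u) * (1 - u) * (3 / 2 - u) * (1 / 2 - u) * (2 - u))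
    by (repeat apply Rmult_le_compat; lra).
  lra.
- apply Qle_bool_imp_le. vm_compute. reflexivity.
Qed.

(** * Rational enclosures of the defects *)

Definition moment_Q (l : list Q) (q : Q) (m : nat) (a : Q) : Q :=
  qevalQ (qprim (qmul l (qpow (qlin q (-1)) (2 * m)))) (q - a).

Lemma is_RInt_close (f g : R -> R) (a b If Ig M : R) : a <= b ->
  is_RInt f a b If -> is_RInt g a b Ig ->
  (forall z, a < z < b -> Rabs (f z - g z) <= M) -> Rabs (If - Ig) <= M * (b - a).
Proof.
intros Hab Hf Hg HM.
assert (H := is_RInt_minus _ _ _ _ _ _ Hf Hg : is_RInt (fun z => f z - g z) a b (If - Ig)).
apply Rabs_le. split.
- replace (- (M * (b - a))) with ((b - a) * - M) by ring.
  apply (is_RInt_le (fun _ => - M) (fun z => f z - g z) a b); trivial.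
    apply (@is_RInt_const R_NormedModule).
  intros z Hz. assert (A := HM z Hz). apply Rabs_le_between in A. lra.
- replace (M * (b - a)) with ((b - a) * M) by ring.
  apply (is_RInt_le (fun z => f z - g z) (fun _ => M) a b); trivial.
    apply (@is_RInt_const R_NormedModule).
  intros z Hz. assert (A := HM z Hz). apply Rabs_le_between in A. lra.
Qed.

Lemma moment_approx (l : list Q) (q a e : Q) (m : nat) :
  0 <= Q2R a < Q2R q -> Q2R q < 7 / 4 ->
  (forall u, 0 < u <= Q2R q - Q2R a -> Rabs (kernel (Q2R q - u) - qeval l u) <= Q2R e) ->
  Rabs (moment m (Q2R a) (Q2R q) - Q2R (moment_Q l q m a))
   <= Q2R e * Q2R q ^ (2 * m) * (Q2R q - Q2R a).
Proof.
intros Ha Hq Hl. set (p := qmul l (qpow (qlin q (-1)) (2 * m))).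
apply (is_RInt_close (fun z => kernel z * z ^ (2 * m)) (fun z => qeval p (Q2R q - z))).
- lra.
- apply is_RInt_moment; lra.
- unfold moment_Q. rewrite <- qeval_Q2R, Q2R_minus. apply is_RInt_qeval_reflected.
- intros z Hz. unfold p. rewrite qeval_mul, qeval_pow, qeval_qlin.
  replace (Q2R (-1)) with (-1) by (unfold Q2R; simpl; field).
  replace (Q2R q + (Q2R q - z) * -1) with z by ring.
  rewrite <- Rmult_minus_distr_r, Rabs_mult.
  assert (Hl' := Hl (Q2R q - z) ltac:(lra)).
  replace (Q2R q - (Q2R q - z)) with z in Hl' by ring.
  rewrite (Rabs_pos_eq (z ^ (2 * m))) by (apply pow_le; lra).
  apply Rmult_le_compat; trivial; [apply Rabs_pos|apply pow_le; lra|apply pow_incr; lra].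
Qed.

Definition defect_Q (m : nat) (x y : Q) : Q :=
  moment_Q kernel_taylor1 (1 # 4) m 0 - moment_Q kernel_taylor2 (3 # 4) m x
  + moment_Q kernel_taylor3 (5 # 4) m y.

Lemma Q2R_q : Q2R (1 # 4) = q1 /\ Q2R (3 # 4) = q2 /\ Q2R (5 # 4) = q3 /\ Q2R 0 = 0.
Proof. unfold Q2R, q1, q2, q3; simpl. repeat split; field. Qed.

(** The integral over [[0, q1]] contributes at most [1.25e-7] to the error, the two others together
    less than [1e-8]. *)
Lemma defect_approx (m : nat) (x y : Q) : (m <= 2)%nat ->
  (72 # 100 <= x)%Q -> (x <= 73 # 100)%Q -> (1233 # 1000 <= y)%Q -> (y <= 124 # 100)%Q ->
  Rabs (defect m (Q2R x) (Q2R y) - Q2R (defect_Q m x y)) <= 2 / 10000000.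
Proof.
intros Hm Hx1 Hx2 Hy1 Hy2. apply Qle_Rle in Hx1, Hx2, Hy1, Hy2.
replace (Q2R (72 # 100)) with (72 / 100) in Hx1 by (unfold Q2R; simpl; field).
replace (Q2R (73 # 100)) with (73 / 100) in Hx2 by (unfold Q2R; simpl; field).
replace (Q2R (1233 # 1000)) with (1233 / 1000) in Hy1 by (unfold Q2R; simpl; field).
replace (Q2R (124 # 100)) with (124 / 100) in Hy2 by (unfold Q2R; simpl; field).
destruct Q2R_q as [E1 [E2 [E3 E0]]].
assert (A1 : Rabs (moment m 0 q1 - Q2R (moment_Q kernel_taylor1 (1 # 4) m 0))
   <= Q2R (5 # 10000000) * q1 ^ (2 * m) * (q1 - 0)).
{ assert (A := moment_approx kernel_taylor1 (1 # 4) 0 (5 # 10000000) m).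
  rewrite E1, E0 in A. apply A; try (unfold q1; lra).
  intros u Hu. apply kernel1_approx. unfold q1 in Hu; lra. }
assert (A2 : Rabs (moment m (Q2R x) q2 - Q2R (moment_Q kernel_taylor2 (3 # 4) m x))
   <= Q2R (2 # 10000000) * q2 ^ (2 * m) * (q2 - Q2R x)).
{ assert (A := moment_approx kernel_taylor2 (3 # 4) x (2 # 10000000) m).
  rewrite E2 in A. apply A; try (unfold q2; lra).
  intros u Hu. apply kernel2_approx. unfold q2 in Hu; lra. }
assert (A3 : Rabs (moment m (Q2R y) q3 - Q2R (moment_Q kernel_taylor3 (5 # 4) m y))
   <= Q2R (3 # 100000000) * q3 ^ (2 * m) * (q3 - Q2R y)).
{ assert (A := moment_approx kernel_taylor3 (5 # 4) y (3 # 100000000) m).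
  rewrite E3 in A. apply A; try (unfold q3; lra).
  intros u Hu. apply kernel3_approx. unfold q3 in Hu; lra. }
unfold defect, defect_Q. rewrite Q2R_plus, Q2R_minus.
assert (P1 : 0 <= q1 ^ (2 * m) <= 1).
{ split; [apply pow_le; unfold q1; lra|]. rewrite <- (pow1 (2 * m)). apply pow_incr. unfold q1; lra. }
assert (P2 : 0 <= q2 ^ (2 * m) <= 1).
{ split; [apply pow_le; unfold q2; lra|]. rewrite <- (pow1 (2 * m)). apply pow_incr. unfold q2; lra. }
assert (P3 : 0 <= q3 ^ (2 * m) <= 3).
{ split; [apply pow_le; unfold q3; lra|]. apply Rle_trans with (q3 ^ 4).
    apply Rle_pow; [unfold q3; lra|lia]. unfold q3; lra. }
replace (Q2R (5 # 10000000)) with (5 / 10000000) in * by (unfold Q2R; simpl; field).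
replace (Q2R (2 # 10000000)) with (2 / 10000000) in * by (unfold Q2R; simpl; field).
replace (Q2R (3 # 100000000)) with (3 / 100000000) in * by (unfold Q2R; simpl; field).
revert P1 P2 P3 A1 A2 A3. generalize (q1 ^ (2 * m)) (q2 ^ (2 * m)) (q3 ^ (2 * m)).
intros v1 v2 v3 P1 P2 P3 A1 A2 A3.
assert (B1 : v1 * (q1 - 0) <= 1 * (1 / 4)) by (apply Rmult_le_compat; unfold q1; lra).
assert (B2 : v2 * (q2 - Q2R x) <= 1 * (3 / 100)) by (apply Rmult_le_compat; unfold q2; lra).
assert (B3 : v3 * (q3 - Q2R y) <= 3 * (17 / 1000)) by (apply Rmult_le_compat; unfold q3; lra).
apply Rabs_le_between in A1, A2, A3. apply Rabs_le. lra.
Qed.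

(** The margin [3e-7] exceeds the error [2e-7], so a weak rational inequality, checked by
    computation, gives a strict real one. *)
Lemma defect_lt (m : nat) (x y r : Q) : (m <= 2)%nat ->
  (72 # 100 <= x)%Q -> (x <= 73 # 100)%Q -> (1233 # 1000 <= y)%Q -> (y <= 124 # 100)%Q ->
  (defect_Q m x y + (3 # 10000000) <= r)%Q -> defect m (Q2R x) (Q2R y) < Q2R r.
Proof.
intros Hm Hx1 Hx2 Hy1 Hy2 H. assert (A := defect_approx m x y Hm Hx1 Hx2 Hy1 Hy2).
apply Qle_Rle in H. rewrite Q2R_plus in H. apply Rabs_le_between in A.
replace (Q2R (3 # 10000000)) with (3 / 10000000) in H by (unfold Q2R; simpl; field). lra.
Qed.

Lemma defect_gt (m : nat) (x y r : Q) : (m <= 2)%nat ->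
  (72 # 100 <= x)%Q -> (x <= 73 # 100)%Q -> (1233 # 1000 <= y)%Q -> (y <= 124 # 100)%Q ->
  (r <= defect_Q m x y - (3 # 10000000))%Q -> Q2R r < defect m (Q2R x) (Q2R y).
Proof.
intros Hm Hx1 Hx2 Hy1 Hy2 H. assert (A := defect_approx m x y Hm Hx1 Hx2 Hy1 Hy2).
apply Qle_Rle in H. rewrite Q2R_minus in H. apply Rabs_le_between in A.
replace (Q2R (3 # 10000000)) with (3 / 10000000) in H by (unfold Q2R; simpl; field). lra.
Qed.

(* Opposite corners of a box around the critical point; the intermediate value
   argument only needs the signs of the defects at these two corners. *)
Definition x_lo : Q := 7209642 # 10000000.
Definition x_hi : Q := 7209653 # 10000000.
Definition y_lo : Q := 1233059 # 1000000.
Definition y_hi : Q := 123306 # 100000.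

Lemma defect_lo_1 : defect 1 (Q2R x_lo) (Q2R y_lo) < 0.
Proof.
(* The reversed rewriting turns the real 0 into [Q2R 0], the form that the rational test expects. *)
destruct Q2R_q as [_ [_ [_ <-]]]. apply defect_lt; [lia|discriminate..|].
apply Qle_bool_imp_le. vm_compute. reflexivity.
Qed.

Lemma defect_lo_2 : 0 < defect 2 (Q2R x_lo) (Q2R y_lo).
Proof.
destruct Q2R_q as [_ [_ [_ <-]]]. apply defect_gt; [lia|discriminate..|].
apply Qle_bool_imp_le. vm_compute. reflexivity.
Qed.

Lemma defect_hi_1 : 0 < defect 1 (Q2R x_hi) (Q2R y_hi).
Proof.
destruct Q2R_q as [_ [_ [_ <-]]]. apply defect_gt; [lia|discriminate..|].
apply Qle_bool_imp_le. vm_compute. reflexivity.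
Qed.

Lemma defect_hi_2 : defect 2 (Q2R x_hi) (Q2R y_hi) < 0.
Proof.
destruct Q2R_q as [_ [_ [_ <-]]]. apply defect_lt; [lia|discriminate..|].
apply Qle_bool_imp_le. vm_compute. reflexivity.
Qed.

(* [4096 / 225] is [kernel 0]. *)
Lemma defect_0_lower : 4096 / 225 / (4 * 1.08177) < defect 0 (Q2R x_lo) (Q2R y_hi).
Proof.
replace (4096 / 225 / (4 * 1.08177)) with (Q2R ((4096 # 225) * (100000 # 432708))).
  apply defect_gt; [lia|discriminate..|]. apply Qle_bool_imp_le. vm_compute. reflexivity.
rewrite Q2R_mult. unfold Q2R; simpl. field.
Qed.

(** As [defect 0] grows with [x] and decreases with [y], its extremes over the box are at the two
    corners other than those used for locating the zero. *)
Lemma defect_0_upper : defect 0 (Q2R x_hi) (Q2R y_lo) < 4096 / 225 / (4 * 1.08176).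
Proof.
replace (4096 / 225 / (4 * 1.08176)) with (Q2R ((4096 # 225) * (100000 # 432704))).
  apply defect_lt; [lia|discriminate..|]. apply Qle_bool_imp_le. vm_compute. reflexivity.
rewrite Q2R_mult. unfold Q2R; simpl. field.
Qed.

(** * The critical point *)

Lemma continuous_moment_l m q a : -1 / 4 < a < 7 / 4 -> -1 / 4 < q < 7 / 4 ->
  continuous (fun a => moment m a q) a.
Proof.
intros Ha Hq. apply (ex_derive_continuous (fun a => moment m a q)).
exists (opp (kernel a * a ^ (2 * m))).
apply (is_derive_RInt' (fun z => kernel z * z ^ (2 * m)) (fun a => moment m a q) a q).
  apply (locally_interval_in _ _ _ _ Ha). intros y Hy. now apply is_RInt_moment.
now apply continuous_kernel_pow.
Qed.

(** The constant coefficient is about 8.38 and the others change it by at most [20 * 3 / 100]. The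
    bound makes [moment 1] strictly monotone in its lower limit at a definite rate. *)
Lemma kernel_lower z : 72 / 100 <= z < 3 / 4 -> 7 <= kernel z.
Proof.
intros Hz. assert (A := kernel2_approx (q2 - z) ltac:(unfold q2; lra)).
replace (q2 - (q2 - z)) with z in A by ring.
set (u := q2 - z) in *. assert (Hu : 0 <= u <= Q2R (3 # 100)).
  unfold u, q2, Q2R; simpl; lra.
assert (B := qeval_bound (tl kernel_taylor2) u (3 # 100) Hu).
assert (C : (qbound (tl kernel_taylor2) (3 # 100) <= 20)%Q).
  apply Qle_bool_imp_le. vm_compute. reflexivity.
apply Qle_Rle in C. replace (Q2R 20) with 20 in C by (unfold Q2R; simpl; field).
change (qeval kernel_taylor2 u) with (Q2R (8377580410 # 1000000000) + u * qeval (tl kernel_taylor2) u) in A.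
set (t := qeval _ u) in *.
replace (Q2R (3 # 100)) with (3 / 100) in * by (unfold Q2R; simpl; field).
replace (Q2R (8377580410 # 1000000000)) with (8377580410 / 1000000000) in * by (unfold Q2R; simpl; field).
replace (Q2R (2 # 10000000)) with (2 / 10000000) in * by (unfold Q2R; simpl; field).
apply Rabs_le_between in A, B. nra.
Qed.

Lemma moment_ge0 m a b : 0 <= a <= b -> b < 7 / 4 -> 0 <= moment m a b.
Proof.
intros Ha Hb. apply RInt_ge_0; [lra| |].
  eexists; apply is_RInt_moment; lra.
intros z Hz. apply Rmult_le_pos; [apply kernel_ge0; lra|apply pow_le; lra].
Qed.

Lemma moment_lower a b : 72 / 100 <= a <= b -> b < 3 / 4 -> 3 * (b - a) <= moment 1 a b.
Proof.
intros Ha Hb. replace (3 * (b - a)) with ((b - a) * 3) by ring.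
apply (is_RInt_le (fun _ => 3) (fun z => kernel z * z ^ (2 * 1)) a b).
- lra.
- apply (@is_RInt_const R_NormedModule).
- apply is_RInt_moment; lra.
- intros z Hz. assert (K := kernel_lower z ltac:(lra)). simpl.
  assert (1 / 2 <= z * (z * 1)) by nra. nra.
Qed.

(** With [moment_ge0], this and the next lemma give monotonicity: defects are nondecreasing in [x]
    and nonincreasing in [y]. *)
Lemma defect_minus_x m x x' y : 0 <= x < 7 / 4 -> 0 <= x' < 7 / 4 ->
  defect m x' y - defect m x y = moment m x x'.
Proof.
intros Hx Hx'. unfold defect.
assert (A := moment_Chasles m x x' q2 ltac:(lra) ltac:(lra) ltac:(unfold q2; lra)). lra.
Qed.

Lemma defect_minus_y m x y y' : 0 <= y < 7 / 4 -> 0 <= y' < 7 / 4 ->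
  defect m x y - defect m x y' = moment m y y'.
Proof.
intros Hy Hy'. unfold defect.
assert (A := moment_Chasles m y y' q3 ltac:(lra) ltac:(lra) ltac:(unfold q3; lra)). lra.
Qed.

(** Projection onto [[a, b]]. Composition with it yields functions on the whole line, so that
    two-sided continuity, as the intermediate value theorem asks, holds at the endpoints too. *)
Definition clamp (a b y : R) : R := Rmax a (Rmin b y).

Lemma clamp_in a b y : a <= b -> a <= clamp a b y <= b.
Proof. intros. unfold clamp, Rmax, Rmin. destruct (Rle_dec b y), (Rle_dec a _); lra. Qed.

Lemma clamp_id a b y : a <= y <= b -> clamp a b y = y.
Proof. intros. unfold clamp, Rmax, Rmin. destruct (Rle_dec b y), (Rle_dec a _); lra. Qed.

Lemma continuous_clamp a b y : a <= b -> continuous (clamp a b) y.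
Proof.
intros Hab. apply continuity_pt_filterlim. intros eps Heps. exists eps. split; trivial.
intros z [_ Hz]. simpl in *. unfold Rdist in *. apply Rle_lt_trans with (2 := Hz).
unfold clamp, Rmax, Rmin.
destruct (Rle_dec b z), (Rle_dec b y); repeat destruct (Rle_dec a _); split_Rabs; lra.
Qed.

(** Two nested uses of the intermediate value theorem: [defect 1 x y = 0] is solved by [x = xi y],
    then [defect 2 (xi y) y = 0] is solved in [y]. Monotonicity carries the signs at the two corners
    to every sign that is required. *)
Lemma critical_point_exists (x0 x1 y0 y1 : R) :
  72 / 100 <= x0 < x1 -> x1 < 3 / 4 -> 1 <= y0 < y1 -> y1 < 5 / 4 ->
  defect 1 x0 y0 < 0 -> 0 < defect 1 x1 y1 -> 0 < defect 2 x0 y0 -> defect 2 x1 y1 < 0 ->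
  exists x y, x0 <= x <= x1 /\ y0 <= y < y1 /\ defect 1 x y = 0 /\ defect 2 x y = 0.
Proof.
intros Hx0 Hx1 Hy0 Hy1 A1 B1 A2 B2.
assert (X : forall y, {x | x0 <= x <= x1 /\ defect 1 x (clamp y0 y1 y) = 0}).
{ intros y. assert (C := clamp_in y0 y1 y ltac:(lra)). set (y' := clamp y0 y1 y) in *.
  apply (IVT_interv (fun x => defect 1 x y')).
  - intros x Hx. apply continuity_pt_filterlim.
    apply (continuous_plus (fun x => moment 1 0 q1 - moment 1 x q2) (fun _ => moment 1 y' q3));
      [|apply continuous_const].
    apply (continuous_minus (fun _ => moment 1 0 q1) (fun x => moment 1 x q2)); [apply continuous_const|].
    apply continuous_moment_l; unfold q2; lra.
  - lra.
  - assert (D := defect_minus_y 1 x0 y0 y' ltac:(lra) ltac:(lra)).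
    assert (M := moment_ge0 1 y0 y' ltac:(lra) ltac:(lra)). lra.
  - assert (D := defect_minus_y 1 x1 y' y1 ltac:(lra) ltac:(lra)).
    assert (M := moment_ge0 1 y' y1 ltac:(lra) ltac:(lra)). lra. }
set (xi := fun y => proj1_sig (X y)).
assert (Hxi : forall y, x0 <= xi y <= x1 /\ defect 1 (xi y) (clamp y0 y1 y) = 0).
{ intros y. exact (proj2_sig (X y)). }
clearbody xi. clear X.
assert (Cq3 : forall m y, continuous (fun y => moment m (clamp y0 y1 y) q3) y).
{ intros m y. assert (C := clamp_in y0 y1 y ltac:(lra)).
  apply (continuous_comp (clamp y0 y1) (fun y => moment m y q3)); [apply continuous_clamp; lra|].
  apply continuous_moment_l; unfold q3; lra. }
(* The lower bound on the kernel makes the inverse of [x => moment 1 x q2] Lipschitz. *)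
assert (Cxi : forall y, continuous xi y).
{ intros y. apply continuity_pt_filterlim. intros eps Heps.
  assert (Cy := Cq3 1%nat y). apply continuity_pt_filterlim in Cy.
  destruct (Cy (3 * eps) ltac:(lra)) as [d [Hd Hy]]. exists d. split; trivial.
  intros z Hz. specialize (Hy z Hz). simpl in *. unfold Rdist in *.
  destruct (Hxi y) as [Iy Ey]. destruct (Hxi z) as [Iz Ez]. unfold defect in Ey, Ez.
  assert (D : Rabs (moment 1 (xi z) q2 - moment 1 (xi y) q2) < 3 * eps).
    replace (moment 1 (xi z) q2 - moment 1 (xi y) q2) with
      (moment 1 (clamp y0 y1 z) q3 - moment 1 (clamp y0 y1 y) q3) by lra. trivial.
  destruct (Rle_dec (xi y) (xi z)) as [L|L].
  - assert (A := moment_lower (xi y) (xi z) ltac:(lra) ltac:(lra)).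
    assert (B := moment_Chasles 1 (xi y) (xi z) q2 ltac:(lra) ltac:(lra) ltac:(unfold q2; lra)).
    split_Rabs; lra.
  - assert (A := moment_lower (xi z) (xi y) ltac:(lra) ltac:(lra)).
    assert (B := moment_Chasles 1 (xi z) (xi y) q2 ltac:(lra) ltac:(lra) ltac:(unfold q2; lra)).
    split_Rabs; lra. }
destruct (IVT_interv (fun y => - defect 2 (xi y) (clamp y0 y1 y)) y0 y1) as [y [Iy Ey]].
- intros y Hy. apply continuity_pt_filterlim. destruct (Hxi y) as [I _].
  apply (continuous_opp (fun y => defect 2 (xi y) (clamp y0 y1 y))).
  apply (continuous_plus (fun y => moment 2 0 q1 - moment 2 (xi y) q2)
    (fun y => moment 2 (clamp y0 y1 y) q3)); [|apply Cq3].
  apply (continuous_minus (fun _ => moment 2 0 q1) (fun y => moment 2 (xi y) q2)); [apply continuous_const|].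
  apply (continuous_comp xi (fun x => moment 2 x q2)); [apply Cxi|].
  apply continuous_moment_l; unfold q2; lra.
- lra.
- destruct (Hxi y0) as [I _]. rewrite clamp_id by lra.
  assert (D := defect_minus_x 2 x0 (xi y0) y0 ltac:(lra) ltac:(lra)).
  assert (M := moment_ge0 2 x0 (xi y0) ltac:(lra) ltac:(lra)). lra.
- destruct (Hxi y1) as [I _]. rewrite clamp_id by lra.
  assert (D := defect_minus_x 2 (xi y1) x1 y1 ltac:(lra) ltac:(lra)).
  assert (M := moment_ge0 2 (xi y1) x1 ltac:(lra) ltac:(lra)). lra.
- destruct (Hxi y) as [I E]. rewrite clamp_id in E, Ey by lra.
  exists (xi y), y. repeat split; try lra.
  (* The case [y = y1] contradicts [defect 2 (xi y1) y1 <= defect 2 x1 y1 < 0]. Strictness matters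
     since [y1] will be 1.23306, the excluded end of the decimal range. *)
  destruct Iy as [Iy1 [Iy2| ->]]; trivial. exfalso.
  assert (D := defect_minus_x 2 (xi y1) x1 y1 ltac:(lra) ltac:(lra)).
  assert (M := moment_ge0 2 (xi y1) x1 ltac:(lra) ltac:(lra)). lra.
Qed.

Lemma critical_point :
  exists x y, 0.72096 <= x < 0.72097 /\ 1.23305 <= y < 1.23306 /\
    defect 1 x y = 0 /\ defect 2 x y = 0 /\
    4096 / 225 / (4 * 1.08177) < defect 0 x y < 4096 / 225 / (4 * 1.08176).
Proof.
assert (X0 : Q2R x_lo = 0.7209642) by (unfold Q2R; simpl; lra).
assert (X1 : Q2R x_hi = 0.7209653) by (unfold Q2R; simpl; lra).
assert (Y0 : Q2R y_lo = 1.233059) by (unfold Q2R; simpl; lra).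
assert (Y1 : Q2R y_hi = 1.23306) by (unfold Q2R; simpl; lra).
assert (D1 := defect_lo_1). assert (D2 := defect_lo_2).
assert (D3 := defect_hi_1). assert (D4 := defect_hi_2).
assert (L := defect_0_lower). assert (U := defect_0_upper).
rewrite X0, Y0 in D1, D2. rewrite X1, Y1 in D3, D4. rewrite X0, Y1 in L. rewrite X1, Y0 in U.
destruct (critical_point_exists 0.7209642 0.7209653 1.233059 1.23306 ltac:(lra) ltac:(lra) ltac:(lra) ltac:(lra) D1 D3 D2 D4)
  as [x [y [Hx [Hy [E1 E2]]]]].
exists x, y. repeat split; try lra.
- assert (A := defect_minus_x 0 0.7209642 x 1.23306 ltac:(lra) ltac:(lra)).
  assert (A' := moment_ge0 0 0.7209642 x ltac:(lra) ltac:(lra)).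
  assert (B := defect_minus_y 0 x y 1.23306 ltac:(lra) ltac:(lra)).
  assert (B' := moment_ge0 0 y 1.23306 ltac:(lra) ltac:(lra)). lra.
- assert (A := defect_minus_x 0 x 0.7209653 1.233059 ltac:(lra) ltac:(lra)).
  assert (A' := moment_ge0 0 x 0.7209653 ltac:(lra) ltac:(lra)).
  assert (B := defect_minus_y 0 x 1.233059 y ltac:(lra) ltac:(lra)).
  assert (B' := moment_ge0 0 1.233059 y ltac:(lra) ltac:(lra)). lra.
Qed.

(** * The extremal trigonometric polynomials *)

(** The number [s] is [sin v / v], taken as 1 at 0; the lower bound is the cubic Taylor bound. *)
Lemma sin_factor v : Rabs v <= 2 -> exists s, 1 - v ^ 2 / 6 <= s <= 1 /\ sin v = v * s.
Proof.
assert (Pos : forall v, 0 < v <= 2 -> exists s, 1 - v ^ 2 / 6 <= s <= 1 /\ sin v = v * s).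
{ intros w Hw. exists (sin w / w). split; [|field; lra].
  destruct (pre_sin_bound w 0 ltac:(lra) ltac:(lra)) as [L _].
  unfold sin_approx, sin_term in L. simpl in L.
  assert (U := sin_lt_x w ltac:(lra)).
  split; apply (Rmult_le_reg_r w); try lra.
    replace (sin w / w * w) with (sin w) by (field; lra). simpl. lra.
  replace (sin w / w * w) with (sin w) by (field; lra). lra. }
intros Hv. apply Rabs_le_between in Hv. destruct (Rtotal_order v 0) as [H|[->|H]].
- destruct (Pos (- v) ltac:(lra)) as [s [Hs E]]. exists s. split.
    now replace (v ^ 2) with ((- v) ^ 2) by ring.
  rewrite sin_neg in E. lra.
- exists 1. rewrite sin_0. lra.
- apply Pos; lra.
Qed.

Lemma PI_sqr_le : PI ^ 2 <= 10.
Proof. assert (A := PI_near). apply Rabs_le_between in A. nra. Qed.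

(** From [cos (u - v) - cos (u + v) = 2 sin u sin v] with [u, v = PI (a +- z) / r]. The two sine
    factors lose at most [(u^2 + v^2) / 6], and [u^2 + v^2 <= 90 / r^2] because [PI^2 <= 10]. *)
Lemma cos_gap_scaled (r a z : R) : 10 <= r -> 0 <= a <= 3 / 2 -> 0 <= z <= 3 / 2 ->
  exists s, 1 - 15 / r ^ 2 <= s <= 1 /\
    cos_gap (z / r) (a / r) = 2 * PI ^ 2 / r ^ 2 * (a ^ 2 - z ^ 2) * s.
Proof.
intros Hr Ha Hz. assert (HP := PI_RGT_0). assert (HP2 := PI_sqr_le).
assert (HP4 := PI_4). assert (Hi : 0 < / r) by (apply Rinv_0_lt_compat; lra).
set (u := PI * (a + z) * / r). set (v := PI * (a - z) * / r).
assert (Hi' : / r <= / 10) by (apply Rinv_le_contravar; lra).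
assert (Hu : 0 <= u <= 12 / 10).
{ split; [unfold u; apply Rmult_le_pos; [apply Rmult_le_pos|]; lra|].
  replace (12 / 10) with (4 * 3 * / 10) by field. unfold u.
  apply Rmult_le_compat; try lra; [apply Rmult_le_pos; lra|apply Rmult_le_compat; lra]. }
assert (Hv : Rabs v <= u).
{ unfold u, v. rewrite !Rabs_mult, (Rabs_pos_eq PI), (Rabs_pos_eq (/ r)) by lra.
  apply Rmult_le_compat_r; [lra|]. apply Rmult_le_compat_l; [lra|]. apply Rabs_le; lra. }
assert (Huv : u ^ 2 + v ^ 2 <= 90 / r ^ 2).
{ replace (u ^ 2 + v ^ 2) with (2 * PI ^ 2 * (a ^ 2 + z ^ 2) * (/ r ^ 2)) by (unfold u, v; field; lra).
  unfold Rdiv. apply Rmult_le_compat_r; [apply Rlt_le, Rinv_0_lt_compat, pow_lt; lra|].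
  assert (0 <= a ^ 2 + z ^ 2 <= 9 / 2) by nra. assert (0 <= PI ^ 2) by (apply pow_le; lra). nra. }
destruct (sin_factor u) as [s [Hs Es]]; [rewrite Rabs_pos_eq; lra|].
destruct (sin_factor v) as [s' [Hs' Es']]; [lra|].
exists (s * s'). split.
- assert (0 <= u ^ 2 <= 2) by nra.
  assert (0 <= v ^ 2 <= 2) by (apply Rabs_le_between in Hv; nra).
  replace (15 / r ^ 2) with (90 / r ^ 2 / 6) by (field; lra). split; [|nra].
  apply Rle_trans with ((1 - u ^ 2 / 6) * (1 - v ^ 2 / 6)); [|apply Rmult_le_compat; lra].
  assert (0 <= u ^ 2 * v ^ 2) by (apply Rmult_le_pos; lra). lra.
- unfold cos_gap.
  replace (2 * PI * (z / r)) with (u - v) by (unfold u, v; field; lra).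
  replace (2 * PI * (a / r)) with (u + v) by (unfold u, v; field; lra).
  rewrite cos_minus, cos_plus.
  transitivity (2 * sin u * sin v); [ring|]. rewrite Es, Es'. unfold u, v. field. lra.
Qed.

(** The products differ from each other by at most [3 e], and dividing by [s1 s2 s3 >= 1 / 2]
    doubles this. *)
Lemma ratio_close (s1 s2 s3 t1 t2 e P T : R) : 0 <= e <= 1 / 6 ->
  1 - e <= s1 <= 1 -> 1 - e <= s2 <= 1 -> 1 - e <= s3 <= 1 ->
  1 - e <= t1 <= 1 -> 1 - e <= t2 <= 1 ->
  T * (s1 * s2 * s3) = P * (t1 * t2) -> Rabs (T - P) <= 6 * e * Rabs P.
Proof.
intros He H1 H2 H3 K1 K2 E.
assert (A12 : 1 - 2 * e <= s1 * s2 <= 1) by nra.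
assert (A : 1 - 3 * e <= s1 * s2 * s3 <= 1) by nra.
assert (B : 1 - 2 * e <= t1 * t2 <= 1) by nra.
set (s := s1 * s2 * s3) in *. set (t := t1 * t2) in *.
assert (Hs : 1 / 2 <= s) by lra.
assert (C : Rabs (T - P) * s = Rabs P * Rabs (t - s)).
{ rewrite <- (Rabs_pos_eq s) at 1 by lra. rewrite <- !Rabs_mult. f_equal. rewrite Rmult_minus_distr_r, E. ring. }
assert (D : Rabs (t - s) <= 3 * e) by (apply Rabs_le; lra).
assert (Q := Rabs_pos P). assert (Q' := Rabs_pos (T - P)).
assert (Rabs P * Rabs (t - s) <= Rabs P * (3 * e)) by (now apply Rmult_le_compat_l).
nra.
Qed.

(** * Comparison with [phihat] and the lower bound on [Cn] *)

Section Asymptotics.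

Variables z1 z2 : R.
Hypothesis Hz1 : 1 / 2 < z1 < q2.
Hypothesis Hz2 : 1 < z2 < q3.

Lemma node_q n : (0 < n)%nat ->
  node n 0 = q1 / INR n /\ node n 1 = q2 / INR n /\ node n 2 = q3 / INR n.
Proof.
intros Hn. apply lt_0_INR in Hn. unfold node, q1, q2, q3. simpl INR. repeat split; field; lra.
Qed.

(** Three gaps in the denominator against two in the numerator leave one factor [2 PI^2 / n^2] on
    the polynomial. The condition [10 <= n] ensures [15 / n^2 <= 1 / 6], as [ratio_close]
    requires. *)
Lemma scaled_close n b z : (10 <= n)%nat ->
  discrete_phihat n (z1 / INR n) (z2 / INR n) (cos_sum b n) ->
  0 <= z <= 3 / 2 -> omega_den z <> 0 ->
  Rabs (2 * PI ^ 2 / INR n ^ 2 * cos_sum b n (z / INR n) - phihat z1 z2 z)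
  <= 90 / INR n ^ 2 * Rabs (phihat z1 z2 z).
Proof.
intros Hn Hb Hz Hd. unfold q2, q3 in Hz1, Hz2.
assert (Hr : 10 <= INR n) by (replace 10 with (INR 10) by (simpl; lra); now apply le_INR).
assert (HP := PI_RGT_0).
destruct (node_q n ltac:(lia)) as [N0 [N1 N2]].
specialize (Hb (z / INR n)). rewrite N0, N1, N2 in Hb.
destruct (cos_gap_scaled (INR n) q1 z Hr ltac:(unfold q1; lra) Hz) as [s1 [A1 E1]].
destruct (cos_gap_scaled (INR n) q2 z Hr ltac:(unfold q2; lra) Hz) as [s2 [A2 E2]].
destruct (cos_gap_scaled (INR n) q3 z Hr ltac:(unfold q3; lra) Hz) as [s3 [A3 E3]].
destruct (cos_gap_scaled (INR n) z1 z Hr ltac:(lra) Hz) as [t1 [B1 F1]].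
destruct (cos_gap_scaled (INR n) z2 z Hr ltac:(lra) Hz) as [t2 [B2 F2]].
rewrite E1, E2, E3, F1, F2 in Hb.
replace (INR n * (z / INR n)) with z in Hb by (field; lra).
set (lam := 2 * PI ^ 2 / INR n ^ 2) in *.
assert (Hlam : 0 < lam).
{ unfold lam. apply Rdiv_lt_0_compat; [|apply pow_lt; lra].
  apply Rmult_lt_0_compat; [lra|apply pow_lt; lra]. }
assert (E : lam * cos_sum b n (z / INR n) * (s1 * s2 * s3) = phihat z1 z2 z * (t1 * t2)).
{ rewrite phihat_kernel, kernel_regular by (trivial; lra). unfold zero_poly, c1.
  apply (Rmult_eq_reg_r (lam ^ 2 * omega_den z)).
  2: apply Rmult_integral_contrapositive_currified; trivial; apply pow_nonzero; lra.
  transitivity (cos (2 * PI * z) * (lam * (z1 ^ 2 - z ^ 2) * t1 * (lam * (z2 ^ 2 - z ^ 2) * t2))).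
    rewrite <- Hb. unfold omega_den. ring.
  field. trivial. }
replace (90 / INR n ^ 2) with (6 * (15 / INR n ^ 2)) by (field; lra).
apply (ratio_close s1 s2 s3 t1 t2); trivial.
split.
- apply Rlt_le, Rdiv_lt_0_compat; [lra|apply pow_lt; lra].
- apply (Rmult_le_reg_r (INR n ^ 2)); [apply pow_lt; lra|].
  unfold Rdiv. rewrite Rmult_assoc, Rinv_l by (apply pow_nonzero; lra). nra.
Qed.

Lemma is_RInt_scaled n b x y : (0 < n)%nat ->
  is_RInt (fun z => cos_sum b n (z / INR n)) x y
   (INR n * cos_sum_primitive b n (y / INR n) - INR n * cos_sum_primitive b n (x / INR n)).
Proof.
intros Hn. apply lt_0_INR in Hn.
apply (is_RInt_derive (fun z => INR n * cos_sum_primitive b n (z / INR n))).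
- intros z _. replace (cos_sum b n (z / INR n)) with (INR n * (/ INR n * cos_sum b n (z / INR n))) by (field; lra).
  apply is_derive_scal.
  apply (is_derive_comp (cos_sum_primitive b n) (fun z => z / INR n)); [apply is_derive_cos_sum_primitive|].
  auto_derive; trivial. field; lra.
- intros z _. apply (continuous_comp (fun z => z / INR n) (cos_sum b n)); [|apply continuous_cos_sum].
  apply (continuous_mult (fun z => z) (fun _ => / INR n)); [apply continuous_id|apply continuous_const].
Qed.

Lemma phihat_bounded : exists M, 0 <= M /\ forall z, 0 <= z <= 3 / 2 -> Rabs (phihat z1 z2 z) <= M.
Proof.
destruct (continuity_ab_maj (fun z => Rabs (phihat z1 z2 z)) 0 (3 / 2)) as [m [Hm _]]; [lra| |].
  intros z Hz. apply continuity_pt_filterlim.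
  apply (continuous_comp (phihat z1 z2) Rabs); [apply continuous_phihat; lra|apply continuous_Rabs].
exists (Rabs (phihat z1 z2 m)). split; [apply Rabs_pos|trivial].
Qed.

Lemma integral_close n b M x y : (10 <= n)%nat ->
  discrete_phihat n (z1 / INR n) (z2 / INR n) (cos_sum b n) ->
  (forall z, 0 <= z <= 3 / 2 -> Rabs (phihat z1 z2 z) <= M) ->
  0 <= x <= y -> y <= 3 / 2 -> (forall z, x < z < y -> z <> q1 /\ z <> q2 /\ z <> q3) ->
  Rabs (2 * PI ^ 2 / INR n ^ 2 *
     (INR n * cos_sum_primitive b n (y / INR n) - INR n * cos_sum_primitive b n (x / INR n))
   - RInt (phihat z1 z2) x y) <= 90 / INR n ^ 2 * M * (y - x).
Proof.
intros Hn Hb HM Hxy Hy Hsing.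
assert (Hr : 0 < INR n) by (apply lt_0_INR; lia).
apply (is_RInt_close (fun z => 2 * PI ^ 2 / INR n ^ 2 * cos_sum b n (z / INR n)) (phihat z1 z2)).
- lra.
- apply (@is_RInt_scal R_NormedModule), is_RInt_scaled; lia.
- apply (@RInt_correct R_CompleteNormedModule), ex_RInt_window; try lra.
  intros; now apply continuous_phihat.
- intros z Hz. destruct (Hsing z Hz) as [S1 [S2 S3]].
  apply Rle_trans with (1 := scaled_close n b z Hn Hb ltac:(lra) (omega_den_neq0 z ltac:(lra) S1 S2 S3)).
  apply Rmult_le_compat_l; [apply Rlt_le, Rdiv_lt_0_compat; [lra|apply pow_lt; lra]|].
  apply HM; lra.
Qed.

(** The form needed for [integral_close]: no [q_k] lies in the interior of an interval of
    integration. *)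
Lemma rho_integrals_split : rho_integrals z1 z2 z1 z2 =
  RInt (phihat z1 z2) 0 q1 - RInt (phihat z1 z2) z1 q2 + RInt (phihat z1 z2) z2 q3.
Proof.
unfold q2, q3 in Hz1, Hz2.
assert (EX : forall a b, -1 / 4 < a < 7 / 4 -> -1 / 4 < b < 7 / 4 -> ex_RInt (phihat z1 z2) a b).
  intros; apply ex_RInt_window; trivial. intros; now apply continuous_phihat.
unfold rho_integrals.
assert (A := RInt_Chasles (phihat z1 z2) z1 z2 q3 ltac:(apply EX; unfold q3; lra) ltac:(apply EX; unfold q3; lra)).
assert (B := RInt_Chasles (phihat z1 z2) z1 q2 q3 ltac:(apply EX; unfold q2, q3; lra) ltac:(apply EX; unfold q2, q3; lra)).
unfold plus in A, B; simpl in A, B. lra.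
Qed.

Lemma normC_exists b n : exists M, is_normC (cos_sum b n) M.
Proof.
destruct (continuity_ab_maj (fun x => Rabs (cos_sum b n x)) (- (1 / 2)) (1 / 2)) as [m [Hm Im]]; [lra| |].
  intros x _. apply continuity_pt_filterlim.
  apply (continuous_comp (cos_sum b n) Rabs); [apply continuous_cos_sum|apply continuous_Rabs].
exists (Rabs (cos_sum b n m)). split.
- exists m. split; trivial. apply Rabs_le. lra.
- intros x Hx. apply Hm. apply Rabs_le_between in Hx. lra.
Qed.

(** The polynomial is evaluated at 0. With [e = 90 / n^2], the scaled value is at least
    [phihat z1 z2 0 * (1 - e)] and the scaled integral at most [D + e M]; the last hypothesis says
    [e M <= D / 2] and keeps that integral positive. *)
Lemma discrete_ratio n M : (10 <= n)%nat -> 0 < rho_integrals z1 z2 z1 z2 ->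
  0 <= M -> (forall z, 0 <= z <= 3 / 2 -> Rabs (phihat z1 z2 z) <= M) ->
  180 * M / INR n ^ 2 <= rho_integrals z1 z2 z1 z2 ->
  Rbar_le (Finite (rho z1 z2 * INR n -
     90 * rho z1 z2 * (1 + M / rho_integrals z1 z2 z1 z2) / INR n)) (Cn n).
Proof.
intros Hn HD HM0 HM Hbig. set (D := rho_integrals z1 z2 z1 z2) in *.
assert (Hr : 10 <= INR n) by (replace 10 with (INR 10) by (simpl; lra); now apply le_INR).
assert (Hr2 : 0 < INR n ^ 2) by (apply pow_lt; lra).
assert (HP := PI_RGT_0).
destruct (discrete_phihat_exists n (z1 / INR n) (z2 / INR n) ltac:(lia)) as [b Hb].
destruct (node_q n ltac:(lia)) as [N0 [N1 N2]].
assert (Hi : 0 < / INR n) by (apply Rinv_0_lt_compat; lra).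
assert (NL := normL_discrete_phihat n (z1 / INR n) (z2 / INR n) b ltac:(lia)).
rewrite N0, N1, N2 in NL. unfold q1, q2, q3 in NL, Hz1, Hz2.
specialize (NL ltac:(unfold Rdiv; split; apply Rmult_lt_compat_r; lra)
  ltac:(unfold Rdiv; split; apply Rmult_lt_compat_r; lra) Hb).
fold q1 q2 q3 in NL, Hz1, Hz2.
set (t := cos_sum b n) in *. set (F := cos_sum_primitive b n) in *.
set (lam := 2 * PI ^ 2 / INR n ^ 2).
assert (Hlam : 0 < lam).
{ unfold lam. apply Rdiv_lt_0_compat; trivial. apply Rmult_lt_0_compat; [lra|apply pow_lt; lra]. }
set (e := 90 / INR n ^ 2).
assert (He : 0 < e <= 9 / 10).
{ split; [apply Rdiv_lt_0_compat; lra|]. apply (Rmult_le_reg_r (INR n ^ 2)); trivial.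
  unfold e, Rdiv at 1. rewrite Rmult_assoc, Rinv_l by lra. nra. }
assert (I1 := integral_close n b M 0 q1 Hn Hb HM ltac:(unfold q1; lra) ltac:(unfold q1; lra)
  ltac:(unfold q1, q2, q3; intros; repeat split; lra)).
assert (I2 := integral_close n b M z1 q2 Hn Hb HM ltac:(unfold q2 in *; lra) ltac:(unfold q2; lra)
  ltac:(unfold q1, q2, q3; intros; repeat split; lra)).
assert (I3 := integral_close n b M z2 q3 Hn Hb HM ltac:(unfold q3 in *; lra) ltac:(unfold q3; lra)
  ltac:(unfold q1, q2, q3; intros; repeat split; lra)).
fold F lam e in I1, I2, I3.
replace (0 / INR n) with 0 in I1 by (field; lra).
rewrite (cos_sum_primitive_0 b n : F 0 = 0) in I1.
set (Dn := INR n * F (q1 / INR n) - (INR n * F (q2 / INR n) - INR n * F (z1 / INR n))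
  + (INR n * F (q3 / INR n) - INR n * F (z2 / INR n))).
assert (NL' : normL t = 4 * Dn / INR n) by (rewrite NL; unfold Dn; field; lra).
assert (HDn : Rabs (lam * Dn - D) <= e * M).
{ unfold D. rewrite rho_integrals_split.
  (* The three intervals have total length below [3 / 4]. *)
  assert (e * M * (q1 - 0) + e * M * (q2 - z1) + e * M * (q3 - z2) <= e * M).
  { assert (0 <= e * M) by (apply Rmult_le_pos; lra). unfold q1, q2, q3 in *. nra. }
  unfold Dn. apply Rabs_le_between in I1, I2, I3. apply Rabs_le. lra. }
assert (HeM : e * M <= D / 2).
{ unfold e. replace (90 / INR n ^ 2 * M) with (180 * M / INR n ^ 2 / 2) by (field; lra). lra. }
assert (T0 := scaled_close n b 0 Hn Hb ltac:(lra)
  ltac:(apply omega_den_neq0; unfold q1, q2, q3; lra)).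
replace (0 / INR n) with 0 in T0 by (field; lra). fold t lam e in T0.
set (P := phihat z1 z2 0) in *.
assert (HPp : 0 < P).
{ unfold P. rewrite phihat_0, kernel_0. apply Rmult_lt_0_compat;
    [apply Rmult_lt_0_compat; apply pow_lt; lra|].
  apply Rinv_0_lt_compat, pow_lt. unfold q1, q2, q3; lra. }
rewrite (Rabs_pos_eq P) in T0 by lra.
assert (Rho : rho z1 z2 = P / (4 * D)) by (unfold rho, P, D, rho_integrals; reflexivity).
apply Rabs_le_between in T0, HDn.
assert (LT : P * (1 - e) <= lam * t 0) by lra.
assert (Ht0 : 0 < t 0).
{ apply (Rmult_lt_reg_l lam); trivial. rewrite Rmult_0_r. apply Rlt_le_trans with (2 := LT).
  apply Rmult_lt_0_compat; lra. }
assert (LD : 0 < lam * Dn <= D + e * M) by lra.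
assert (HDn0 : 0 < Dn).
{ apply (Rmult_lt_reg_l lam); trivial. lra. }
assert (Key : rho z1 z2 * INR n - 90 * rho z1 z2 * (1 + M / D) / INR n <= t 0 / normL t).
{ rewrite NL', Rho.
  replace (P / (4 * D) * INR n - 90 * (P / (4 * D)) * (1 + M / D) / INR n) with
    (INR n / 4 * (P * (1 - e - e * M / D) / D)) by (unfold e; field; lra).
  replace (t 0 / (4 * Dn / INR n)) with (INR n / 4 * (lam * t 0 / (lam * Dn))) by (field; lra).
  apply Rmult_le_compat_l; [lra|].
  (* The first half is [1 - e - e M / D <= (1 - e) / (1 + e M / D)], after clearing denominators. *)
  apply Rle_trans with (P * (1 - e) / (D + e * M)).
  - assert (0 <= e * M) by (apply Rmult_le_pos; lra).
    apply (Rmult_le_reg_r (D * (D + e * M))); [apply Rmult_lt_0_compat; lra|].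
    replace (P * (1 - e) / (D + e * M) * (D * (D + e * M))) with (P * ((1 - e) * D)) by (field; lra).
    replace (P * (1 - e - e * M / D) / D * (D * (D + e * M))) with
      (P * ((1 - e) * D - e * (e * M) - (e * M) ^ 2 / D)) by (field; lra).
    apply Rmult_le_compat_l; [lra|].
    assert (0 <= e * (e * M)) by (apply Rmult_le_pos; lra).
    assert (0 <= (e * M) ^ 2 / D).
      apply Rmult_le_pos; [apply pow_le; lra|apply Rlt_le, Rinv_0_lt_compat; lra].
    lra.
  - apply Rmult_le_compat; trivial.
      apply Rmult_le_pos; lra.
      apply Rlt_le, Rinv_0_lt_compat; lra.
    apply Rinv_le_contravar; lra. }
destruct (normC_exists b n) as [m Hm]. fold t in Hm.
assert (HNL : 0 < normL t) by (rewrite NL'; apply Rdiv_lt_0_compat; lra).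
apply Rbar_le_trans with (Finite (m / normL t)).
- simpl. apply Rle_trans with (1 := Key).
  apply Rmult_le_compat_r; [now apply Rlt_le, Rinv_0_lt_compat|].
  destruct Hm as [_ Hm]. apply Rle_trans with (1 := Rle_abs _). apply Hm.
  rewrite Rabs_R0; lra.
- unfold Cn. match goal with |- Rbar_le _ (Lub_Rbar ?E) => apply (proj1 (Lub_Rbar_correct E)) end.
  exists t, m. split; [apply cos_sum_real_trig_poly|]. split; [exists 0; lra|]. now split.
Qed.

Lemma Cn_lower_bound : 0 < rho_integrals z1 z2 z1 z2 ->
  exists (K : R) (N : nat), forall n : nat, (1 <= n)%nat -> (N <= n)%nat ->
    Rbar_le (Finite (rho z1 z2 * INR n - K / INR n)) (Cn n).
Proof.
intros HD. destruct phihat_bounded as [M [HM0 HM]].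
set (D := rho_integrals z1 z2 z1 z2) in *.
destruct (INR_unbounded (180 * M / D)) as [N HN].
(* Beyond [N] one has [180 M / D <= n <= n^2], which is the largeness condition of
   [discrete_ratio]. *)
exists (90 * rho z1 z2 * (1 + M / D)), (max 10 N). intros n _ Hn.
apply discrete_ratio; trivial; [lia|]. fold D.
assert (Hr : 10 <= INR n) by (replace 10 with (INR 10) by (simpl; lra); apply le_INR; lia).
assert (HN' : INR N <= INR n) by (apply le_INR; lia).
assert (A : 180 * M <= INR n * D).
{ apply (Rmult_le_reg_r (/ D)); [now apply Rinv_0_lt_compat|].
  rewrite (Rmult_assoc (INR n)), Rinv_r by lra. unfold Rdiv in HN. lra. }
apply (Rmult_le_reg_r (INR n ^ 2)); [apply pow_lt; lra|].
unfold Rdiv. rewrite Rmult_assoc, Rinv_l by (apply pow_nonzero; lra).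
assert (INR n * D <= D * INR n ^ 2) by nra. lra.
Qed.

End Asymptotics.

Theorem mainTheorem2 :
  exists z1s z2s : R,
    region z1s z2s /\
    (forall z1 z2 : R, region z1 z2 -> rho z1 z2 <= rho z1s z2s) /\
    0.72096 <= z1s < 0.72097 /\
    1.23305 <= z2s < 1.23306 /\
    1.08176 <= rho z1s z2s < 1.08177 /\
    (exists K : R, exists N : nat, forall n : nat, (1 <= n)%nat -> (N <= n)%nat ->
       Rbar_le (Finite (rho z1s z2s * INR n - K / INR n)) (Cn n)).
Proof.
destruct critical_point as [x [y [Hx [Hy [E1 [E2 E0]]]]]].
assert (Hreg : region x y) by (unfold region; lra).
assert (D0 : 0 < defect 0 x y) by lra.
exists x, y. split; [trivial|]. split; [|split; [trivial|split; [trivial|split]]].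
- intros z1 z2. now apply rho_le_critical.
- rewrite rho_critical by trivial.
  replace (kernel 0) with (4096 / 225) by (rewrite kernel_0; unfold q1, q2, q3; field).
  split.
  + apply (Rmult_le_reg_r (4 * defect 0 x y)); [lra|].
    replace (4096 / 225 / (4 * defect 0 x y) * (4 * defect 0 x y)) with (4096 / 225) by (field; lra). lra.
  + apply (Rmult_lt_reg_r (4 * defect 0 x y)); [lra|].
    replace (4096 / 225 / (4 * defect 0 x y) * (4 * defect 0 x y)) with (4096 / 225) by (field; lra). lra.
(* The located digits give [x < q2] and [y < q3]; by the two equations the denominator reduces to
   [x^2 y^2 defect 0 x y > 0]. *)
- apply Cn_lower_bound; [unfold q2; lra|unfold q3; lra|].
  rewrite rho_integrals_defect, E1, E2 by lra.
  assert (0 < x ^ 2 * y ^ 2 * defect 0 x y); [|lra].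
  repeat apply Rmult_lt_0_compat; lra.
Qed.
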